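(* For any type $\sigma$ and block $d^m$, \[ s_{\sigma}^{\otimes}P_{d^m}=\sum_{\tau} \operatorname{sgn}(R)\,\operatorname{wt}(R)\,s_{\tau}^{\otimes}, \] where we sum over types $\tau$ that arise from $\sigma$ by adding a $(dm/k)$-ribbon $R$ to the diagram $\mathrm{dg}(\sigma|_k)$ for some integer $k>0$ that divides $d$ (all other components of $\sigma$ being unchanged), and $\operatorname{wt}(R)=k$.
   Context: An integer partition is a finite (possibly empty) weakly decreasing sequence of positive integers. A block is an ordered pair of positive integers written $d^m$ (degree $d$, multiplicity $m$). Blocks are ordered by $a^b\ge d^e$ iff $a>d$, or $a=d$ and $b\ge e$. A type is a finite (possibly empty) weakly decreasing sequence of blocks $\tau=(d_1^{m_1},\dots,d_s^{m_s})$. For $k\ge1$, $\tau|_k$ denotes the integer partition formed by the multiplicities of the blocks of $\tau$ of degree $k$; the type $\tau$ is determined by the sequence $(\tau|_k)_{k\ge1}$. Variables: $x_{k,j}$ for $k,j\ge 1$, with $\deg x_{k,j}=k$; $\mathbf{x}_{k*}=(x_{k,1},x_{k,2},\dots)$. The algebra $\mathsf{P\Lambda}$ of polysymmetric functions consists of the formal series over $\mathbb{Q}$ of bounded degree in all the $x_{k,j}$ that, for each fixed $k$, are unchanged by any permutation of the variables $\mathbf{x}_{k*}$. Define $s^{\otimes}_\tau=\prod_{k\ge1}s_{\tau|_k}(\mathbf{x}_{k*})$, where $s_\lambda$ is the Schur symmetric function. Define $P_d=\sum_{k\mid d}k\sum_{j\ge1}x_{k,j}^{d/k}$ (sum over positive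 divisors $k$ of $d$), and let $P_{d^m}$ be obtained from $P_d$ by replacing every variable $x_{k,j}$ by $x_{k,j}^m$. The diagram $\mathrm{dg}(\mu)$ is the set of boxes $(i,j)$ with $1\le i\le\ell(\mu)$, $1\le j\le\mu_i$ (row $1$ at the top, left-justified). For $\mathrm{dg}(\mu)\subseteq\mathrm{dg}(\nu)$, the skew shape $\nu/\mu$ is $\mathrm{dg}(\nu)\setminus\mathrm{dg}(\mu)$. It is a $k$-ribbon if it consists of $k$ boxes that can be labeled $b_1,\dots,b_k$ so that for $1<i\le k$, $b_i$ is one unit left of or one unit below $b_{i-1}$. If a ribbon $R$ has boxes in exactly $r$ different rows, $\operatorname{sgn}(R)=(-1)^{r-1}$. Adding a ribbon to $\mathrm{dg}(\mu)$ means passing from $\mu$ to a partition $\nu$ with $\nu/\mu$ a ribbon. *)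

(* Defs.v *)
From HB Require Import structures.
From mathcomp Require Import all_boot all_order all_algebra.
From mathcomp Require Import finmap.
From mathcomp Require Import mathcomp_extra boolp classical_sets functions.
From mathcomp Require Import cardinality fsbigop.
From mathcomp.multinomials Require Import monalg.

Set Implicit Arguments.
Unset Strict Implicit.
Unset Printing Implicit Defensive.

Import GRing.Theory.

Local Open Scope classical_set_scope.
Local Open Scope ring_scope.

(* Formal power series over R in the variables indexed by I, given by their   *)
(* coefficients: {cmonom I} is the monoid of monomials (finitely supported    *)
(* exponents).                                                                *)
Definition series (I : choiceType) (R : comNzRingType) : Type :=
  {cmonom I} -> R.

Section SeriesRing.
Variables (I : choiceType) (R : comNzRingType).
Local Notation series := (series I R).
Local Notation mon := {cmonom I}.

Implicit Types (f g h : series) (u v w : mon) (F G : {malg R[mon]}).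

HB.instance Definition _ := gen_eqMixin series.
HB.instance Definition _ := gen_choiceMixin series.

Definition series_add f g : series := fun u => f u + g u.
Definition series_opp f : series := fun u => - f u.

Fact series_addA : associative series_add.
Proof. by move=> f g h; apply/funext => u; rewrite /series_add addrA. Qed.
Fact series_addC : commutative series_add.
Proof. by move=> f g; apply/funext => u; rewrite /series_add addrC. Qed.
Fact series_add0 : left_id (fun=> 0) series_add.
Proof. by move=> f; apply/funext => u; rewrite /series_add add0r. Qed.
Fact series_addN : left_inverse (fun=> 0) series_opp series_add.
Proof. by move=> f; apply/funext => u; rewrite /series_add addNr. Qed.

HB.instance Definition _ := GRing.isZmodule.Build series
  series_addA series_addC series_add0 series_addN.

Lemma series_addE f g u : (f + g) u = f u + g u. Proof. by []. Qed.

Definition series_one : series := fun u => (u == mone)%:R.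

(* The index set is finite, so this is the full Cauchy product. *)
Definition series_mul f g : series :=
  fun u => \sum_(p \in [set p : mon * mon | mmul p.1 p.2 = u]) f p.1 * g p.2.

Definition mon_dvd v u := exists w, mmul v w = u.

Lemma finite_mon_divisors u :
  exists D : {fset mon}, forall v, mon_dvd v u -> v \in D.
Proof.
pose h (t : {ffun finsupp u -> 'I_(\max_(i <- finsupp u) u i).+1}) : mon :=
  [cmonom oapp (fun j => nat_of_ord (t j)) 0%N (insub i) | i in finsupp u]%M.
have hfin : finite_set [set h t | t in [set: _]].
  exact/finite_image/finite_finset.
exists (fset_set [set h t | t in [set: _]]) => v [w vw].
have leu i : (v i <= u i)%N by rewrite -vw cmM leq_addr.
rewrite in_fset_set// inE/=.
exists [ffun i => inord (v (val i))] => //.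
apply/eqP/cmP => i; rewrite /h cmE fsfunE.
case: ifPn => [iu|iu].
  rewrite (insubT (fun i => i \in finsupp u) iu)/= ffunE/= inordK// ltnS.
  exact/(leq_trans (leu i))/(@leq_bigmax_seq _ _ _ (fun j => u j)).
have ui0 : u i = 0%N by apply/eqP; rewrite cmE_eq0.
by have := leu i; rewrite ui0 leqn0 => /eqP ->.
Qed.

Lemma finite_mon_factors u :
  finite_set [set p : mon * mon | mmul p.1 p.2 = u].
Proof.
have [D DP] := finite_mon_divisors u.
apply: (@sub_finite_set _ _ ([set` D] `*` [set` D])).
  move=> -[v w] /= vw; split=> /=; apply: DP; first by exists w.
  by exists v; rewrite mulmC.
exact/finite_setX.
Qed.

Lemma series_mul_malg f g F G u :
    (forall v, mon_dvd v u -> F@_v = f v) -> (forall v, mon_dvd v u -> G@_v = g v) ->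
  series_mul f g u = (F * G)@_u.
Proof.
move=> Ff Gg.
have [D DP] := finite_mon_divisors u.
set E := fun F : {malg R[mon]} => (msupp F `|` D)%fset.
rewrite (@mcoeffMlw _ _ (E F) (E G)) ?fsubsetUl//.
transitivity (\sum_(p <- [seq (x, y) | x <- E F, y <- E G] |
    mmul p.1 p.2 == u) F@_p.1 * G@_p.2); last first.
  by rewrite big_mkcond big_allpairs/=; do 2 (apply: eq_bigr => ? _);
    rewrite mulrb.
rewrite /series_mul.
set A := [set p : mon * mon | _]; set r := [seq (x, y) | x <- E F, y <- E G].
have inr p : A p -> p \in r.
  case: p => v w; rewrite /A /= => vw; apply/allpairsP; exists (v, w).
  split=> //=; rewrite in_fsetU DP ?orbT//; first by exists w.
  by exists v; rewrite mulmC.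
rewrite (fsbigE [seq p <- r | mmul p.1 p.2 == u]).
- rewrite big_filter_cond/=; apply: eq_big => [p|p].
    by case: eqP => //= pu; apply/mem_set.
  case/andP=> /eqP pu _; rewrite Ff ?Gg//; first by exists p.1; rewrite mulmC.
  by exists p.2.
- rewrite filter_uniq// allpairs_uniq ?fset_uniq// => -[? ?] [? ?] _ _ [-> ->] //.
- by move=> p /=; rewrite mem_filter => /andP[/eqP].
- move=> p Ap; rewrite mem_filter inr// andbT; move: Ap; rewrite /A /= => ->.
  by rewrite eqxx.
Qed.

Lemma malg_approx f u : exists F, forall v, mon_dvd v u -> F@_v = f v.
Proof.
have [D DP] := finite_mon_divisors u; exists [malg v in D => f v].
by move=> v /DP vD; rewrite mcoeffE vD.
Qed.

Lemma mon_dvd_refl u : mon_dvd u u. Proof. by exists mone; rewrite mulm1. Qed.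
Lemma mon_dvd_trans v u w : mon_dvd v u -> mon_dvd w v -> mon_dvd w u.
Proof. by move=> [a <-] [b <-]; exists (mmul b a); rewrite mulmA. Qed.

Fact series_mulA : associative series_mul.
Proof.
move=> f g h; apply/funext => u.
have [[[F Ff] [G Gg]] [H Hh]] := (malg_approx f u, malg_approx g u, malg_approx h u).
rewrite (@series_mul_malg f (series_mul g h) F (G * H))//; last first.
  by move=> v vu; rewrite (@series_mul_malg g h G H)// => w wv;
    rewrite ?Gg ?Hh//; apply: mon_dvd_trans wv.
rewrite (@series_mul_malg (series_mul f g) h (F * G) H) ?mulrA//.
by move=> v vu; rewrite (@series_mul_malg f g F G)// => w wv;
  rewrite ?Ff ?Gg//; apply: mon_dvd_trans wv.
Qed.

Fact series_mulC : commutative series_mul.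
Proof.
move=> f g; apply/funext => u.
have [[F Ff] [G Gg]] := (malg_approx f u, malg_approx g u).
by rewrite (series_mul_malg Ff Gg) (series_mul_malg Gg Ff) mulrC.
Qed.

Fact series_mul1 : left_id series_one series_mul.
Proof.
move=> f; apply/funext => u; have [F Ff] := malg_approx f u.
rewrite (@series_mul_malg series_one f 1 F)//; last first.
  by move=> v _; rewrite mcoeff1.
by rewrite mul1r Ff//; exact: mon_dvd_refl.
Qed.

Fact series_mulDl : left_distributive series_mul +%R.
Proof.
move=> f g h; apply/funext => u.
have [[[F Ff] [G Gg]] [H Hh]] := (malg_approx f u, malg_approx g u, malg_approx h u).
rewrite (@series_mul_malg (f + g) h (F + G) H)//; last first.
  by move=> v vu; rewrite mcoeffD Ff// Gg.
by rewrite mulrDl mcoeffD series_addE (series_mul_malg Ff Hh) (series_mul_malg Gg Hh).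
Qed.

Fact series_one_neq0 : series_one != 0.
Proof.
apply/eqP => /(congr1 (fun f => f mone))/eqP.
by rewrite /series_one eqxx oner_eq0.
Qed.

HB.instance Definition _ := GRing.Zmodule_isComNzRing.Build series
  series_mulA series_mulC series_mul1 series_mulDl series_one_neq0.

Lemma series_oneE u : (1 : series) u = (u == mone)%:R. Proof. by []. Qed.

Lemma series_mulE f g u : (f * g) u =
  \sum_(p \in [set p : mon * mon | mmul p.1 p.2 = u]) f p.1 * g p.2.
Proof. by []. Qed.

Definition series_scale (a : R) f : series := fun u => a * f u.

Fact series_scaleA a b f : series_scale a (series_scale b f) = series_scale (a * b) f.
Proof. by apply/funext => u; rewrite /series_scale mulrA. Qed.
Fact series_scale1 : left_id 1 series_scale.
Proof. by move=> f; apply/funext => u; rewrite /series_scale mul1r. Qed.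
Fact series_scaleDr : right_distributive series_scale +%R.
Proof. by move=> a f g; apply/funext => u; rewrite /series_scale series_addE mulrDr. Qed.
Fact series_scaleDl f : {morph series_scale^~ f : a b / a + b}.
Proof. by move=> a b; apply/funext => u; rewrite /series_scale series_addE mulrDl. Qed.

HB.instance Definition _ := GRing.Zmodule_isLmodule.Build R series
  series_scaleA series_scale1 series_scaleDr series_scaleDl.

Lemma series_scaleE a f u : (a *: f) u = a * f u. Proof. by []. Qed.

Definition series_var (i : I) : series := fun u => (u == ucm i)%:R.

(* The sum of a possibly infinite family in which every monomial has a        *)
(* nonzero coefficient in only finitely many members.                         *)
Definition series_sum (J : choiceType) (A : set J) (F : J -> series) : series :=
  fun u => \sum_(j \in A) F j u.

(* The substitution x_i |-> x_i ^ m, for 0 < m: it sends each monomial v to   *)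
(* v ^ m.                                                                     *)
Definition series_powvars (m : nat) f : series :=
  fun u => \sum_(v \in [set v | expcmn v m = u]) f v.

End SeriesRing.

(* Boxes are numbered from 0: row i of the diagram is {i} x [0, mu_i).        *)
Definition dg (mu : seq nat) : {fset nat * nat} :=
  [fset b in [seq (i, j) | i <- iota 0 (size mu), j <- iota 0 (nth 0%N mu i)]]%fset.

Definition skew_shape (nu mu : seq nat) : {fset nat * nat} := (dg nu `\` dg mu)%fset.

Definition left_or_below : rel (nat * nat) := fun b c =>
  ((c.1 == b.1) && (c.2.+1 == b.2)) || ((c.1 == b.1.+1) && (c.2 == b.2)).

Definition is_ribbon (k : nat) (R : {fset nat * nat}) : Prop :=
  exists s : seq (nat * nat),
    [/\ size s = k, uniq s, s =i R & sorted left_or_below s].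

Definition ribbon_sgn (R : {fset nat * nat}) : rat :=
  (-1) ^+ (#|` [fset b.1 | b in R]%fset |).-1.

(* The pair (d, m) is the block d ^ m.                                        *)
Definition block : Type := (nat * nat)%type.

Definition block_ge : rel block := fun a b =>
  (b.1 < a.1)%N || ((a.1 == b.1) && (b.2 <= a.2)%N).

Definition is_type (tau : seq block) : bool :=
  sorted block_ge tau && all (fun b => (0 < b.1)%N && (0 < b.2)%N) tau.

Definition restr (tau : seq block) (k : nat) : seq nat :=
  [seq b.2 | b <- tau & b.1 == k].

(* The variable x_{k,j} is indexed by (k, j); the indices with k = 0 or j = 0 *)
(* are not used by any of the series below.                                   *)
Notation pseries := (series (nat * nat)%type rat).

Definition xvar (k j : nat) : pseries := series_var _ (k, j).

(* A tableau is given by the list of its rows. *)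
Definition is_ssyt (mu : seq nat) (T : seq (seq nat)) : Prop :=
  [/\ shape T = mu,
      all (all (leq 1)) T,
      all (sorted leq) T &
      forall i j, (i.+1, j) \in dg mu ->
        (nth 0%N (nth [::] T i) j < nth 0%N (nth [::] T i.+1) j)%N].

(* The Schur function s_mu in the variables x_{k,1}, x_{k,2}, ... *)
Definition schur (mu : seq nat) (k : nat) : pseries :=
  series_sum [set T | is_ssyt mu T] (fun T => \prod_(j <- flatten T) xvar k j).

(* All factors of degree k greater than the degrees of the blocks of tau are  *)
(* equal to 1.                                                                *)
Definition schur_tensor (tau : seq block) : pseries :=
  \prod_(1 <= k < (\max_(b <- tau) b.1).+1) schur (restr tau k) k.

Definition Pdeg (d : nat) : pseries :=
  \sum_(k <- divisors d)
    k%:R *: series_sum [set j | (0 < j)%N] (fun j => xvar k j ^+ (d %/ k)).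

Definition Pblock (d m : nat) : pseries := series_powvars m (Pdeg d).

(* The type tau arises from sigma by adding an n-ribbon to dg(sigma|_k).      *)
Definition adds_ribbon (n k : nat) (sigma tau : seq block) : Prop :=
  [/\ is_type tau,
      forall j, j != k -> restr tau j = restr sigma j,
      (dg (restr sigma k) `<=` dg (restr tau k))%fset &
      is_ribbon n (skew_shape (restr tau k) (restr sigma k))].

(* Since k is determined by sigma and tau, summing over the types that arise  *)
(* for some k amounts to summing over all pairs (k, tau).                     *)
Lemma adds_ribbon_degree_uniq n n' k k' sigma tau : (0 < n)%N ->
  adds_ribbon n k sigma tau -> adds_ribbon n' k' sigma tau -> k = k'.
Proof.
move=> n0 [_ _ _ [s [sn _ sR _]]] [_ tau' _ _]; apply/eqP/negPn/negP => kk'.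
move: sR; rewrite tau'// /skew_shape fsetDv.
by case: s sn => [sn|b s _ /(_ b)]; [move: n0; rewrite -sn|rewrite mem_head inE].
Qed.

(* Main.v *)
Require Import Defs.
From HB Require Import structures.
From mathcomp Require Import all_boot all_order all_algebra.
From mathcomp Require Import finmap.
From mathcomp Require Import mathcomp_extra boolp classical_sets functions.
From mathcomp Require Import cardinality fsbigop.
From mathcomp.multinomials Require Import mpoly monalg.
From mathcomp Require Import perm zify.

(** The block [d ^ m] gives [P_(d^m) = \sum_(k | d) k * p_(dm/k)(x_k)], where
    [p_n(x_k)] is a power sum in the variables of degree [k] alone
    ([Pblock_power_sum]).  Multiplying [schur_tensor sigma] by [p_n(x_k)] only
    changes its factor of degree [k], so the statement reduces to the
    Murnaghan-Nakayama rule [s_mu * p_n = \sum_nu sgn(nu/mu) s_nu] in one set of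
    variables ([schur_power_sum]), followed by the bijection between types
    obtained from [sigma] and partitions obtained from [sigma|_k]
    ([schur_tensor_power_sum]).

    The Murnaghan-Nakayama rule is proved in [N] variables with alternants
    [a_alpha = det (x_i ^ alpha_j)].  By the Leibniz formula
    [a_alpha * p_n = \sum_j a_(alpha + n e_j)] ([alternant_power_sum]).  When
    [alpha = mu + (N-1, ..., 0)], sorting the exponents [alpha + n e_j] either
    finds a repetition, and the alternant vanishes, or moves the entry up from
    row [j] to row [i], at the cost of the sign [(-1)^(j-i)]; subtracting the
    staircase again, the result is [mu] with an [n]-ribbon added in the rows
    [i, ..., j] ([alternant_straighten], [ribbon_is_ribbon_row],
    [ribbon_row_is_ribbon]).

    What links alternants to tableaux is the identity [a_(mu + delta) = V * s_mu],
    with [V] the product of the differences of the variables ([bialternant]).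
    Both sides obey the same recursion on [N].  For tableaux, erasing the entries
    equal to the largest letter leaves a tableau whose shape interlaces with
    [mu] ([schur_poly_tableaux]); for alternants, subtracting from each row of the
    matrix a multiple of the next one makes the last column vanish except for one
    entry, and in the remaining minor, up to one common factor per column, the
    rows become geometric sums over the parts of the same interlacing shapes
    ([alternant_branching]).

    The factor [V] is cancelled in the polynomial ring over the integers, an
    integral domain, and the resulting identity is specialized to an arbitrary
    commutative ring ([murnaghan_nakayama_schur_poly]).  Finally, the coefficient
    of a given monomial in a series only involves finitely many variables, so
    [N] can be chosen large enough depending on the monomial ([schur_coef],
    [power_sum_coef]). *)

Import GRing.Theory.

Local Open Scope classical_set_scope.
Local Open Scope ring_scope.

Set Implicit Arguments.
Unset Strict Implicit.
Unset Printing Implicit Defensive.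

(** * Determinants whose rows are sums *)

Section CartesianProduct.
Variable T : eqType.

Fixpoint listprod (rs : seq (seq T)) : seq (seq T) :=
  if rs is r :: rs' then [seq b :: be | b <- r, be <- listprod rs'] else [:: [::]].

Lemma mem_listprod rs x0 be : (be \in listprod rs) =
  (size be == size rs) && all (fun j => nth x0 be j \in nth [::] rs j) (iota 0 (size rs)).
Proof.
elim: rs be => [|r rs IH] [|b be] //=; first by apply/negbTE/allpairsP => -[[]]/= ? ? [].
rewrite eqSS; have -> : (b :: be \in [seq b :: be | b <- r, be <- listprod rs])
    = (b \in r) && (be \in listprod rs).
  by apply/allpairsP/andP => [[[? ?]/= [? ? [-> ->]]]//|[? ?]]; exists (b, be).
rewrite IH andbCA; congr (_ && (_ && _)).
by rewrite (iotaDl 1) all_map.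
Qed.

Lemma uniq_listprod rs : all uniq rs -> uniq (listprod rs).
Proof.
elim: rs => //= r rs IH /andP[ur /IH urs]; apply: allpairs_uniq => //.
by move=> [? ?] [? ?] _ _ /= [-> ->].
Qed.

Lemma prod_sum_listprod (R : comNzRingType) rs x0 (g : nat -> T -> R) :
  \prod_(j < size rs) \sum_(b <- nth [::] rs j) g j b =
  \sum_(be <- listprod rs) \prod_(j < size rs) g j (nth x0 be j).
Proof.
elim: rs g => [|r rs IH] g /=; first by rewrite big_ord0 big_seq1 big_ord0.
rewrite big_ord_recl big_allpairs_dep/= big_distrl/=; apply: eq_bigr => b _.
rewrite (eq_bigr (fun j : 'I_(size rs) => \sum_(b <- nth [::] rs j) g j.+1 b)) //.
rewrite (IH (fun j => g j.+1)) big_distrr/=; apply: eq_bigr => be _.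
by rewrite big_ord_recl.
Qed.

(** Multilinearity in the rows, in the form used for the branching of
    alternants: every row is a sum over its own list of indices. *)
Lemma det_sum_listprod (R : comNzRingType) N rs x0 (f : nat -> T -> 'I_N -> R) :
  size rs = N ->
  \det (\matrix_(j < N, i < N) \sum_(b <- nth [::] rs j) f j b i) =
  \sum_(be <- listprod rs) \det (\matrix_(j < N, i < N) f j (nth x0 be j) i).
Proof.
move=> sN; rewrite exchange_big /=; apply: eq_bigr => s _; rewrite -mulr_sumr.
congr (_ * _); under eq_bigr => j _ do rewrite mxE.
under [RHS]eq_bigr => be _ do under eq_bigr => j _ do rewrite mxE.
case: N / sN f s => f s.
pose g j b := if (insub j : option 'I_(size rs)) is Some i then f j b (s i) else 0.
have gE (j : 'I_(size rs)) b : f j b (s j) = g j b by rewrite /g valK.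
under eq_bigr => j _ do under eq_bigr => b _ do rewrite gE.
rewrite (prod_sum_listprod _ x0); apply: eq_bigr => be _.
by apply: eq_bigr => j _; rewrite gE.
Qed.

End CartesianProduct.

(** * Interlacing sequences and the branching of alternants *)

(** Reading entries with default [0] makes trailing zeros invisible, so that
    partitions of different lengths can be compared. *)
Definition decr (mu : seq nat) := forall i, (nth 0 mu i.+1 <= nth 0 mu i)%N.

Lemma sorted_decr mu : sorted geq mu -> decr mu.
Proof.
move=> smu i; have [ismu|ismu] := ltnP i.+1 (size mu); last by rewrite nth_default.
apply: (sorted_leq_nth _ _ 0%N smu); rewrite ?inE ?(ltnW ismu) //.
- by move=> a b c ba cb; apply: leq_trans cb ba.
- exact: leqnn.
Qed.

(** The first [N] rows of the shapes left when the largest of [N.+1] letters is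
    erased from a tableau of shape [mu]: the erased boxes form a horizontal
    strip. *)
Definition interlacing N (mu : seq nat) : seq (seq nat) :=
  listprod [seq index_iota (nth 0%N mu j.+1) (nth 0%N mu j).+1 | j <- iota 0 N].

Lemma mem_interlacing N mu nu : (nu \in interlacing N mu) <->
  size nu = N /\ (forall j, (j < N)%N -> (nth 0 mu j.+1 <= nth 0 nu j <= nth 0 mu j)%N).
Proof.
rewrite /interlacing (mem_listprod _ 0%N) size_map size_iota; split.
  move=> /andP[/eqP sn /allP H]; split => // j jN; have := H j; rewrite mem_iota => /(_ jN).
  by rewrite (nth_map 0%N) ?size_iota// nth_iota// mem_index_iota ltnS.
move=> [-> H]; rewrite eqxx; apply/allP => j; rewrite mem_iota => /= jN.
by rewrite (nth_map 0%N) ?size_iota// nth_iota// mem_index_iota ltnS H.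
Qed.

Lemma uniq_interlacing N mu : uniq (interlacing N mu).
Proof. by apply: uniq_listprod; apply/allP => r /mapP[j _ ->]; rewrite iota_uniq. Qed.

Lemma interlacing_decr N mu nu : nu \in interlacing N mu -> decr nu.
Proof.
move=> /mem_interlacing[sn H] j; have [jN|jN] := ltnP j.+1 N; last by rewrite nth_default// sn.
by have := H j.+1 jN; have := H j (ltnW jN); lia.
Qed.

Section Branching.
Variables (R : comNzRingType) (x : nat -> R).

(** The Schur polynomial in the variables [x 1, ..., x N], defined by the branching
    rule; [schur_poly_tableaux] recovers the sum over tableaux.  As
    [nu] has size [N'], its entry in the last factor of the product is [0]. *)
Fixpoint schur_poly N mu : R :=
  if N is N'.+1 then
    \sum_(nu <- interlacing N' mu)
      schur_poly N' nu * \prod_(j < N) x N ^+ (nth 0 mu j - nth 0 nu j)%N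
  else 1.

Definition alternant N (a : nat -> nat) : R :=
  \det (\matrix_(j < N, i < N) x i.+1 ^+ a j).

Definition add_staircase N (mu : nat -> nat) (j : nat) : nat := (mu j + (N.-1 - j))%N.

Fixpoint vandermonde_prod N : R :=
  if N is N'.+1 then vandermonde_prod N' * \prod_(i < N') (x i.+1 - x N) else 1.

(** The geometric sum produced by one row operation: [m1] and [m0] are
    consecutive parts of [mu], and the sum ranges over the values that the
    interlacing part between them can take. *)
Lemma telescope_pow (s t : R) m0 m1 c : (m1 <= m0)%N ->
  s ^+ (m0 + c.+1) - t ^+ (m0 - m1).+1 * s ^+ (m1 + c) =
  (s - t) * \sum_(b <- index_iota m1 m0.+1) s ^+ (b + c) * t ^+ (m0 - b).
Proof.
move=> /subnKC <-; set d := (m0 - m1)%N; rewrite addKn.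
have -> : (m1 + d + c.+1 = d.+1 + (m1 + c))%N by lia.
rewrite exprD -mulrBl -[s ^+ d.+1 - _]opprB subrXX -mulNr opprB -mulrA.
have -> : index_iota m1 (m1 + d).+1 = index_iota (0 + m1) (d.+1 + m1) by rewrite addnC.
congr (_ * _); rewrite big_addn addnK big_mkord mulr_suml.
apply: eq_bigr => i _; rewrite -(mulrA) [RHS]mulrC.
by congr (_ * _); [congr (_ ^+ _); lia|rewrite -exprD; congr (_ ^+ _); lia].
Qed.

(** Put [y = x N.+1].  Subtracting [y ^ (a_j - a_(j+1))] times row [j+1] from row
    [j] kills the column of [y] above its last entry [y ^ a_N].  The
    entries left in the other columns and rows [j < N] are divisible by [x_i - y],
    with quotient the sum of [telescope_pow] over the interlacing parts. *)
Lemma alternant_branching N mu : decr mu ->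
  alternant N.+1 (add_staircase N.+1 (nth 0%N mu)) =
  (\prod_(i < N) (x i.+1 - x N.+1)) *
  \sum_(nu <- interlacing N mu) alternant N (add_staircase N (nth 0%N nu)) *
    \prod_(j < N.+1) x N.+1 ^+ (nth 0 mu j - nth 0 nu j)%N.
Proof.
move=> dmu; set y := x N.+1; set a := add_staircase _ _.
pose M := \matrix_(j < N.+1, i < N.+1) x i.+1 ^+ a j.
(* The row operations, as multiplication by an upper unitriangular matrix. *)
pose L : 'M[R]_N.+1 := \matrix_(j, k) ((j == k)%:R - (k == j.+1 :> nat)%:R * y ^+ (a j - a k)).
have detL : \det L = 1.
  rewrite -det_tr det_trig; last first.
    apply/is_trig_mxP => i j ij; rewrite !mxE -val_eqE/= [val j == _]gtn_eqF//.
    by rewrite [val i == _]ltn_eqF ?mul0r ?subr0// ltnS ltnW.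
  rewrite big1// => i _; rewrite !mxE eqxx [val i == _]ltn_eqF// mul0r subr0//.
have -> : alternant N.+1 a = \det (L *m M) by rewrite det_mulmx detL mul1r.
have LM (j i : 'I_N.+1) : (L *m M) j i = x i.+1 ^+ a j -
    (j < N)%N%:R * y ^+ (a j - a j.+1) * x i.+1 ^+ a j.+1.
  rewrite mxE; under eq_bigr do rewrite !mxE mulrBl.
  rewrite sumrB (bigD1 j)//= eqxx mul1r big1 ?addr0; last first.
    by move=> k kj; rewrite eq_sym (negbTE kj) mul0r.
  congr (_ - _); have [jN|jN] := ltnP j N; last first.
    rewrite !mul0r big1// => k _; rewrite [val k == _]ltn_eqF ?mul0r//.
    by apply: leq_trans (ltn_ord k) _.
  rewrite (bigD1 (Ordinal (jN : (j.+1 < N.+1)%N)))//= eqxx mul1r big1 ?addr0 ?mul1r//.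
  by move=> k; rewrite -val_eqE /= => /negbTE ->; rewrite !mul0r.
rewrite (expand_det_col _ ord_max) (bigD1 ord_max)//= big1 ?addr0; last first.
  move=> j; rewrite -val_eqE/= => jN; have {}jN : (j < N)%N by have := ltn_ord j; lia.
  rewrite LM jN mul1r -exprD subnK ?subrr ?mul0r//.
  by rewrite /a /add_staircase; have := dmu j; lia.
rewrite LM/= ltnn !mul0r subr0 /cofactor addnn -signr_odd odd_double expr0 mul1r.
pose rs := [seq index_iota (nth 0%N mu j.+1) (nth 0%N mu j).+1 | j <- iota 0 N].
pose f j b (i : 'I_N) : R := x i.+1 ^+ (b + (N.-1 - j)) * y ^+ (nth 0 mu j - b)%N.
have -> : row' ord_max (col' ord_max (L *m M)) =
  (\matrix_(j < N, i < N) \sum_(b <- nth [::] rs j) f j b i) *m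
    diag_mx (\row_i (x i.+1 - y)).
  apply/matrixP => j i; rewrite mul_mx_diag.
  rewrite [RHS]mxE [X in _ = X * _]mxE [X in _ = _ * X]mxE [LHS]mxE [LHS]mxE LM !lift_max ltn_ord mul1r.
  rewrite (nth_map 0%N) ?size_iota// nth_iota// add0n [RHS]mulrC.
  have jN := ltn_ord j; rewrite /f -telescope_pow; last exact: dmu.
  rewrite /a /add_staircase/=; have -> : (N - j = (N.-1 - j).+1)%N by lia.
  have -> : (N - j.+1 = N.-1 - j)%N by lia.
  congr (_ - _ ^+ _ * _); have := dmu j.
  by move: (nth _ mu j.+1) (nth _ mu j) (N.-1 - j)%N => p q r; lia.
rewrite det_mulmx det_diag [X in _ * (_ * X)](eq_bigr (fun i : 'I_N => x i.+1 - y)); last first.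
  by move=> i _; rewrite mxE.
rewrite mulrA mulrC; congr (_ * _).
rewrite (det_sum_listprod 0%N) ?size_map ?size_iota// mulr_sumr -/(interlacing N mu).
rewrite [LHS]big_seq [RHS]big_seq; apply: eq_bigr => nu /mem_interlacing[snu _].
have -> : \matrix_(j < N, i < N) f j (nth 0%N nu j) i =
   diag_mx (\row_(j < N) y ^+ (nth 0 mu j - nth 0 nu j)%N) *m
     \matrix_(j < N, i < N) x i.+1 ^+ add_staircase N (nth 0%N nu) j.
  by apply/matrixP => j i; rewrite mul_diag_mx !mxE mulrC.
rewrite det_mulmx det_diag -/(alternant _ _) mulrCA mulrA [LHS]mulrC; congr (_ * _).
rewrite big_ord_recr/= [nth _ nu N]nth_default ?snu// subn0; congr (_ * _).
  by apply: eq_bigr => i _; rewrite mxE.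
by rewrite /a /add_staircase /= subnn addn0.
Qed.

(** Both sides satisfy the same recursion, by [alternant_branching] and by
    definition of [schur_poly]. *)
Lemma bialternant N mu : decr mu ->
  alternant N (add_staircase N (nth 0%N mu)) = vandermonde_prod N * schur_poly N mu.
Proof.
elim: N mu => [|N IH] mu dmu; first by rewrite /alternant det_mx00 mulr1.
rewrite alternant_branching//= [vandermonde_prod N * _]mulrC -mulrA; congr (_ * _).
rewrite mulr_sumr big_seq [RHS]big_seq; apply: eq_bigr => nu numu.
by rewrite IH ?mulrA//; apply: interlacing_decr numu.
Qed.

(** * Power sums times alternants *)

Lemma alternant_ext N a b : (forall l, (l < N)%N -> a l = b l) -> alternant N a = alternant N b.
Proof. by move=> E; congr (\det _); apply/matrixP => j i; rewrite !mxE E. Qed.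

Lemma alternant_eq0 N a i j : (i < N)%N -> (j < N)%N -> i != j -> a i = a j -> alternant N a = 0.
Proof.
move=> iN jN ij E; apply: (@determinant_alternate _ _ _ (Ordinal iN) (Ordinal jN)) => //.
by move=> k; rewrite !mxE /= E.
Qed.

Lemma alternant_swap N a i : (i.+1 < N)%N ->
  alternant N (fun l => if l == i then a i.+1 else if l == i.+1 then a i else a l) =
  - alternant N a.
Proof.
move=> iN; pose i0 : 'I_N := Ordinal (ltnW iN); pose i1 : 'I_N := Ordinal iN.
rewrite -mulN1r /alternant; set A := (X in -1 * \det X).
have -> : -1 = \det (tperm_mx i0 i1 : 'M[R]_N).
  by rewrite det_perm odd_tperm -val_eqE/= ltn_eqF ?expr1.
rewrite -det_mulmx -xrowE; congr (\det _); apply/matrixP => j k; rewrite !mxE.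
case: tpermP => [->|->|/eqP/= ji0 /eqP/= ji1]; rewrite /= ?eqxx //.
  by rewrite gtn_eqF.
by move: ji0 ji1; rewrite -!val_eqE/= => /negbTE -> /negbTE ->.
Qed.

(** The sequence [a] with its entry number [j] replaced by [v] and carried up to
    position [i]; the entries in between go down by one position. *)
Definition move_entry (i j v : nat) (a : nat -> nat) (l : nat) : nat :=
  if (l < i)%N then a l else if l == i then v else if (l <= j)%N then a l.-1 else a l.

(** The entry is carried up by [j - i] transpositions of adjacent rows. *)
Lemma alternant_move_entry N a v i j : (i <= j < N)%N ->
  alternant N (move_entry j j v a) = (-1) ^+ (j - i) * alternant N (move_entry i j v a).
Proof.
move=> /andP[/subnKC <-]; move: (j - i)%N => d; rewrite addKn.
elim: d i => [|d IH] i; first by rewrite addn0 mul1r.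
rewrite -addSnnS => idN; rewrite IH// exprSr -mulrA mulN1r -(@alternant_swap _ _ i); last lia.
congr (_ * _); apply: alternant_ext => l lN; rewrite /move_entry.
have [->|li] := eqVneq l i; first by rewrite ltnSn ltnNge leqnSn/= gtn_eqF// addSn ltnS leq_addr.
have [->|li1] := eqVneq l i.+1; first by rewrite !ltnn !eqxx.
by have -> : (l < i.+1)%N = (l < i)%N by lia.
Qed.

(** In the term of the Leibniz formula attached to [s], the variable
    [x_(s j)] occurs with exponent [a j]; the power sum, reindexed by [s], raises
    the exponents of row [j] in all terms at once. *)
Lemma alternant_power_sum N a n : alternant N a * \sum_(i < N) x i.+1 ^+ n =
  \sum_(j < N) alternant N (move_entry j j (a j + n) a).
Proof.
rewrite exchange_big mulr_suml; apply: eq_bigr => s _; rewrite -mulrA -mulr_sumr; congr (_ * _).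
rewrite [X in _ * X](reindex_perm s)/= mulr_sumr; apply: eq_bigr => j _.
rewrite (bigD1 j)//= [RHS](bigD1 j)//= !mxE mulrAC; congr (_ * _).
  by rewrite /move_entry ltnn eqxx exprD.
apply: eq_bigr => l lj; rewrite !mxE; congr (_ ^+ _).
rewrite /move_entry; move: lj; rewrite -val_eqE /=; case: ltngtP => //.
Qed.

End Branching.

(** * Straightening and the rows of a ribbon *)

Section RibbonInsertion.
Variables (m : nat -> nat) (n : nat).
Hypothesis dm : forall i, (m i.+1 <= m i)%N.

(** The partition [m] after adding an [n]-ribbon in the rows [i, ..., j]: below
    its first row a ribbon ends one column after the end of the row above in [m],
    since consecutive rows of a ribbon share exactly one column.  The length of
    row [i] is then determined by the number [n] of boxes. *)
Definition ribbon_row (i j l : nat) : nat :=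
  if (l < i)%N then m l else if l == i then (m j + n + i - j)%N
  else if (l <= j)%N then (m l.-1).+1 else m l.

(** The strictly decreasing sequence [add_staircase N m], with entry [j]
    increased by [n], is sorted by moving this entry to position [i]: the two
    inequalities compare it with the entries number [i] and [i - 1], the terms in
    [N] being cancelled. *)
Definition ribbon_fits (i j : nat) : bool :=
  [&& (i <= j)%N, (m i + j < m j + n + i)%N & (i == 0%N) || (m j + n + i <= m i.-1 + j)%N].

Lemma decr_leq i j : (i <= j)%N -> (m j <= m i)%N.
Proof.
move=> /subnKC <-; elim: (j - i)%N => [|d IH]; first by rewrite addn0.
by rewrite addnS; apply: leq_trans (dm _) IH.
Qed.

Lemma add_staircase_ribbon_row N i j l : ribbon_fits i j -> (j < N)%N -> (l < N)%N ->
  add_staircase N (ribbon_row i j) l = move_entry i j (add_staircase N m j + n) (add_staircase N m) l.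
Proof.
move=> /and3P[ij v _] jN lN; rewrite /add_staircase /ribbon_row /move_entry.
case: ltngtP => // [il|->]; last by lia.
by case: leqP => // lj; lia.
Qed.

Lemma ribbon_fits_uniq i i' j : ribbon_fits i j -> ribbon_fits i' j -> i = i'.
Proof.
move=> /and3P[ij v1 v2] /and3P[ij' v1' v2']; have [|ii'|//] := ltngtP i i'.
  move=> ii'; have := @decr_leq i i'.-1; lia.
by have := @decr_leq i' i.-1; lia.
Qed.

(** Let [i] be the first position whose entry is smaller than the increased
    one.  Either [i] satisfies [ribbon_fits], or the entry just above is equal to
    the increased one, and then the alternant is zero and the sum is empty. *)
Lemma alternant_straighten (R : comNzRingType) (x : nat -> R) N j : (0 < n)%N -> (j < N)%N ->
  alternant x N (move_entry j j (add_staircase N m j + n) (add_staircase N m)) =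
  \sum_(i < j.+1 | ribbon_fits i j) (-1) ^+ (j - i) * alternant x N (add_staircase N (ribbon_row i j)).
Proof.
move=> n0 jN.
(* The inequality says that entry [i] of [add_staircase N m] is smaller. *)
have ex : exists i, (m i + j < m j + n + i)%N by exists j; lia.
have [i iP imin] := ex_minnP ex.
have ij : (i <= j)%N by apply: imin; lia.
have [vi|vi] := boolP (ribbon_fits i j).
  rewrite (bigD1 (Ordinal (ij : (i < j.+1)%N)))//= big1 ?addr0; last first.
    move=> k /andP[vk]; rewrite -val_eqE/= => /eqP[]; exact: ribbon_fits_uniq vk vi.
  rewrite (@alternant_move_entry _ _ _ _ _ i) ?ij//; congr (_ * _).
  by apply: alternant_ext => l lN; rewrite add_staircase_ribbon_row.
rewrite big1; last first.
  move=> k vk; have ki : i = k :> nat.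
    have /and3P[kj v1 v2] := vk; have := imin _ v1.
    have := @decr_leq i k.-1; lia.
  by move: vi; rewrite ki vk.
have {vi} : (i != 0%N) && (m i.-1 + j < m j + n + i)%N.
  by move: vi; rewrite /ribbon_fits ij iP/= negb_or ltnNge.
move=> /andP[i0 vi]; have := imin i.-1; move/implyP; rewrite implybE => H.
have E : add_staircase N m i.-1 = (add_staircase N m j + n)%N by rewrite /add_staircase; lia.
apply: (@alternant_eq0 _ _ _ _ i.-1 j) => //; [lia|by apply/eqP; lia|].
by rewrite /move_entry ltnn eqxx; have -> : (i.-1 < j)%N by lia.
Qed.

Lemma ribbon_row_decr i j l : ribbon_fits i j -> (ribbon_row i j l.+1 <= ribbon_row i j l)%N.
Proof.
move=> /and3P[ij v1 v2]; rewrite /ribbon_row /=.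
have d1 := dm l; have d2 : (m l <= m l.-1)%N by case: (l).
have d3 : l = i -> m l = m i by move->.
have d4 : l.+1 = i -> m l = m i.-1 by move=> <-.
have d5 : i = j -> m i = m j by move->.
by case: (ltngtP l i) => li; case: (ltngtP l.+1 i) => li1; case: (leqP l.+1 j) => lj1;
  case: (leqP l j) => lj; lia.
Qed.

End RibbonInsertion.

(** * The Murnaghan-Nakayama rule for Schur polynomials *)

(** The length is chosen so that there are no trailing zeros when [mu] has
    none. *)
Definition ribbon_addition mu n i j := mkseq (ribbon_row (nth 0%N mu) n i j) (maxn (size mu) j.+1).

Lemma nth_ribbon_addition mu n i j : (i <= j)%N ->
  nth 0%N (ribbon_addition mu n i j) =1 ribbon_row (nth 0%N mu) n i j.
Proof.
move=> ij l; have [ls|ls] := ltnP l (maxn (size mu) j.+1); first by rewrite nth_mkseq.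
rewrite nth_default ?size_mkseq// /ribbon_row.
have -> : (l < i)%N = false by lia.
have -> : (l == i) = false by lia.
have -> : (l <= j)%N = false by lia.
by rewrite nth_default//; lia.
Qed.

Lemma decr_ribbon_addition mu n i j : decr mu -> ribbon_fits (nth 0%N mu) n i j -> decr (ribbon_addition mu n i j).
Proof.
by move=> dmu v l; have /andP[ij _] := v; rewrite !nth_ribbon_addition//; exact: ribbon_row_decr.
Qed.

Definition murnaghan_nakayama (R : comNzRingType) (x : nat -> R) N mu n :=
  schur_poly x N mu * \sum_(i < N) x i.+1 ^+ n =
  \sum_(j < N) \sum_(i < j.+1 | ribbon_fits (nth 0%N mu) n i j)
    (-1) ^+ (j - i) * schur_poly x N (ribbon_addition mu n i j).

(** After multiplication by [vandermonde_prod x N], all the Schur polynomials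
    become alternants. *)
Lemma murnaghan_nakayama_idomain (R : idomainType) (x : nat -> R) N mu n :
  vandermonde_prod x N != 0 -> decr mu -> (0 < n)%N -> murnaghan_nakayama x N mu n.
Proof.
move=> v0 dmu n0; apply: (mulfI v0).
rewrite mulrA -bialternant// alternant_power_sum mulr_sumr; apply: eq_bigr => j _.
rewrite alternant_straighten// mulr_sumr; apply: eq_bigr => i vi.
rewrite mulrCA -bialternant; last exact: decr_ribbon_addition.
congr (_ * _); apply: alternant_ext => l lN.
by rewrite /add_staircase nth_ribbon_addition// -ltnS.
Qed.

Section Transport.
Variables (R S : comNzRingType) (f : {rmorphism R -> S}).

Lemma rmorph_schur_poly x y N mu : (forall i, (i < N)%N -> f (x i.+1) = y i.+1) ->
  f (schur_poly x N mu) = schur_poly y N mu.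
Proof.
elim: N mu => [|N IH] mu E; first by rewrite rmorph1.
rewrite rmorph_sum; apply: eq_bigr => nu _; rewrite rmorphM rmorph_prod; congr (_ * _).
  by apply: IH => i iN; apply: E; exact: ltnW.
by apply: eq_bigr => j _; rewrite rmorphXn E.
Qed.

Lemma rmorph_vandermonde_prod x y N : (forall i, (i < N)%N -> f (x i.+1) = y i.+1) ->
  f (vandermonde_prod x N) = vandermonde_prod y N.
Proof.
elim: N => [|N IH] E; first by rewrite rmorph1.
rewrite rmorphM rmorph_prod; congr (_ * _).
  by apply: IH => i iN; apply: E; exact: ltnW.
by apply: eq_bigr => j _; rewrite rmorphB !E// ltnW// ltnS.
Qed.

End Transport.

(** The rule is a polynomial identity with integer coefficients, so it is enough
    to know it for the indeterminates.  The product of their differences is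
    nonzero because it is so after evaluation at distinct integers. *)
Lemma murnaghan_nakayama_schur_poly (R : comNzRingType) (x : nat -> R) N mu n :
  decr mu -> (0 < n)%N -> murnaghan_nakayama x N mu n.
Proof.
move=> dmu n0.
(* Variables are numbered from 1, so [X k] is the indeterminate of index [k - 1]. *)
pose X k : mpoly.mpoly N int := if (insub k.-1 : option 'I_N) is Some i then mpoly.mpolyX _ (mpoly.mnm1 i) else 0.
pose phi (S : comNzRingType) (y : nat -> S) : {rmorphism mpoly.mpoly N int -> S} :=
  mpoly.mmap (intr : int -> S) (fun i : 'I_N => y i.+1).
have phiX (S : comNzRingType) (y : nat -> S) i : (i < N)%N -> phi S y (X i.+1) = y i.+1.
  by move=> iN; rewrite /X /= insubT/= mpoly.mmapX mpoly.mmap1U.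
have v0 : vandermonde_prod X N != 0.
  apply/eqP => /(congr1 (phi int (fun i => i%:R))).
  rewrite rmorph0 (rmorph_vandermonde_prod (y := fun i => i%:R)); last exact: phiX.
  move/eqP; elim: {X phi phiX} N => [|M IH] //=; rewrite mulf_eq0 => /orP[/IH//|].
  by rewrite prodf_seq_eq0 => /hasP[i _]; rewrite subr_eq0 Num.Theory.eqr_nat; have := ltn_ord i; lia.
have := congr1 (phi R x) (murnaghan_nakayama_idomain v0 dmu n0); rewrite /murnaghan_nakayama.
rewrite rmorphM (rmorph_schur_poly (y := x)); last exact: phiX.
rewrite !rmorph_sum => E; etransitivity; last etransitivity; [|exact: E|].
  by congr (_ * _); apply: eq_bigr => i _; rewrite rmorphXn phiX.
apply: eq_bigr => j _; rewrite rmorph_sum; apply: eq_bigr => i _.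
by rewrite rmorphM rmorph_sign (rmorph_schur_poly (y := x)) //; exact: phiX.
Qed.

(** * Tableaux with bounded entries *)

Lemma mem_dg mu i j : ((i, j) \in dg mu) = (j < nth 0 mu i)%N.
Proof.
rewrite !inE/=; apply/allpairsPdep/idP => [[i'][j'][]|jmu].
  by rewrite !mem_iota /= add0n => imu jmu [-> ->].
exists i, j; rewrite !mem_iota/= jmu; split=> //.
by rewrite ltnNge; apply: contraTN jmu => imu; rewrite nth_default.
Qed.

Definition bounded N (T : seq (seq nat)) := all (all (geq N)) T.

(** Used with [T] a tableau of shape [nu] and [y] larger than its entries; then
    [keep_low_entries] recovers [T]. *)
Definition add_top_entries y mu nu (T : seq (seq nat)) : seq (seq nat) :=
  mkseq (fun i => nth [::] T i ++ nseq (nth 0 mu i - nth 0 nu i)%N y) (size mu).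

Definition keep_low_entries N (U : seq (seq nat)) : seq (seq nat) :=
  mkseq (fun i => [seq t <- nth [::] U i | (t <= N)%N]) N.

Fixpoint tableaux N mu : seq (seq (seq nat)) :=
  if N is N'.+1 then [seq add_top_entries N mu nu T | nu <- interlacing N' mu, T <- tableaux N' nu] else [:: [::]].

Lemma ssyt_size mu T i : is_ssyt mu T -> size (nth [::] T i) = nth 0%N mu i.
Proof. by case=> <- _ _ _; rewrite nth_shape. Qed.

Lemma boundedP N T : reflect (forall i j, (j < size (nth [::] T i))%N -> (nth 0 (nth [::] T i) j <= N)%N)
  (bounded N T).
Proof.
apply: (iffP (all_nthP [::])) => [H i j jT|H i iT].
  have iT : (i < size T)%N by rewrite ltnNge; apply: contraTN jT => iT; rewrite nth_default.
  by have /all_nthP := H _ iT; apply.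
by apply/(all_nthP 0%N) => j jT; apply: H.
Qed.

(** Columns increase strictly and start with a positive entry. *)
Lemma ssyt_row mu T i j : is_ssyt mu T -> decr mu -> (j < nth 0 mu i)%N ->
  (i < nth 0 (nth [::] T i) j)%N.
Proof.
move=> sT dmu; elim: i => [|i IH] jmu.
  have [shT /all_nthP H _ _] := sT.
  have T0 : (0 < size T)%N.
    by rewrite ltnNge; apply: contraTN jmu => T0; rewrite -(ssyt_size _ sT) nth_default.
  by have /all_nthP := H [::] 0%N T0; apply; rewrite (ssyt_size _ sT).
have [_ _ _ H] := sT; apply: leq_ltn_trans (H i j _); last by rewrite mem_dg.
by apply: IH; apply: leq_trans jmu (dmu i).
Qed.

Lemma sorted_split N (r : seq nat) : sorted leq r -> all (geq N.+1) r ->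
  r = [seq t <- r | (t <= N)%N] ++ nseq (size r - size [seq t <- r | (t <= N)%N]) N.+1.
Proof.
elim: r => //= a r IH ar /andP[aN rN].
have [aN'|aN'] := leqP a N.
  by rewrite /= subSS -IH//; exact: path_sorted ar.
have {aN aN'}aE : a = N.+1 by apply/eqP; rewrite eqn_leq aN.
have rE : r = nseq (size r) N.+1.
  apply/all_pred1P/allP => t tr; rewrite /= eqn_leq; apply/andP; split.
    by have /allP := rN; apply.
  by have /allP := order_path_min leq_trans ar; rewrite -aE; apply.
rewrite (_ : filter _ r = [::]) /= ?subn0 -?rE ?aE//.
by rewrite rE; elim: (size r) => //= k ->; rewrite ltnn.
Qed.

Section GlueStep.
Variables (N : nat) (mu : seq nat).
Hypothesis dmu : decr mu.

Lemma nth_add_top_entries nu T i : nu \in interlacing N mu -> is_ssyt nu T ->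
  nth [::] (add_top_entries N.+1 mu nu T) i =
  nth [::] T i ++ nseq (nth 0 mu i - nth 0 nu i)%N N.+1.
Proof.
move=> /mem_interlacing[snu H] sT; have [im|im] := ltnP i (size mu); first by rewrite nth_mkseq.
rewrite nth_default ?size_mkseq//; have mi : nth 0%N mu i = 0%N by rewrite nth_default.
rewrite mi sub0n cats0; apply/esym/size0nil; rewrite (ssyt_size _ sT).
have [iN|iN] := ltnP i N; last by rewrite nth_default// snu.
by have := H i iN; rewrite mi leqn0 => /andP[_ /eqP].
Qed.

Lemma interlacing_leq nu i : nu \in interlacing N mu -> (nth 0 nu i <= nth 0 mu i)%N.
Proof.
move=> /mem_interlacing[snu H]; have [iN|iN] := ltnP i N; first by have /andP[] := H i iN.
by rewrite nth_default// snu.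
Qed.

Lemma add_top_entries_ssyt nu T : (size mu <= N.+1)%N -> nu \in interlacing N mu -> is_ssyt nu T -> bounded N T ->
  is_ssyt mu (add_top_entries N.+1 mu nu T) /\ bounded N.+1 (add_top_entries N.+1 mu nu T).
Proof.
move=> smu numu sT /boundedP bT; have sz := ssyt_size _ sT.
have nG := nth_add_top_entries _ numu sT; have [_ pT rT cT] := sT; have [snu H] := (mem_interlacing _ _ _).1 numu.
have bG : bounded N.+1 (add_top_entries N.+1 mu nu T).
  apply/boundedP => i j; rewrite nG size_cat size_nseq nth_cat nth_nseq => jG.
  by case: ltnP => jT; [apply: leqW; apply: bT|case: ifP].
split=> //; split.
- apply: (@eq_from_nth _ 0%N); rewrite size_map size_mkseq// => i im.
  by rewrite nth_shape nG size_cat size_nseq sz subnKC// interlacing_leq.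
- apply/(all_nthP [::]) => i _; rewrite nG all_cat all_nseq orbT andbT.
  have [iT|iT] := ltnP i (size T); last by rewrite nth_default.
  by have /all_nthP := pT; apply.
- apply/(all_nthP [::]) => i _; rewrite nG.
  rewrite (sorted_pairwise leq_trans) pairwise_cat; apply/and3P; split.
  + apply/allrelP => a b aT; rewrite mem_nseq => /andP[_ /eqP ->]; apply: leqW.
    by have /(nthP 0%N)[j jT <-] := aT; apply: bT.
  + rewrite -(sorted_pairwise leq_trans).
    have [iT|iT] := ltnP i (size T); last by rewrite nth_default.
    by have /all_nthP := rT; apply.
  + by elim: (_ - _)%N => //= k ->; rewrite all_nseq leqnn orbT.
- move=> i j; rewrite mem_dg => jm; rewrite !nG.
  have jN : (j < nth 0 nu i)%N.
    have [iN|iN] := ltnP i N; first by have /andP[h _] := H i iN; exact: leq_trans jm h.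
    by move: jm; rewrite nth_default//; lia.
  rewrite nth_cat sz jN nth_cat sz; case: (ltnP j) => jn; first by apply: cT; rewrite mem_dg.
  by rewrite nth_nseq ltn_sub2r ?(leq_ltn_trans jn jm)// ltnS bT// sz.
Qed.

Lemma add_top_entriesK nu T : nu \in interlacing N mu -> is_ssyt nu T -> bounded N T ->
  keep_low_entries N (add_top_entries N.+1 mu nu T) = T.
Proof.
move=> numu sT /boundedP bT; have [snu _] := (mem_interlacing _ _ _).1 numu.
have sizeT : size T = N by have [shT _ _ _] := sT; rewrite -snu -shT size_map.
apply: (@eq_from_nth _ [::]); rewrite size_mkseq ?sizeT// => i iN.
rewrite nth_mkseq// nth_add_top_entries// filter_cat -[RHS]cats0; congr (_ ++ _).
  by apply/all_filterP/(all_nthP 0%N) => j jT; apply: bT.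
by elim: (_ - _)%N => //= k ->; rewrite ltnn.
Qed.

(** The shape left is interlacing: if row [i] lost a box above a box of row
    [i + 1], the entry below it would exceed [N.+1]. *)
Lemma keep_low_entries_ssyt U : is_ssyt mu U -> bounded N.+1 U ->
  let T := keep_low_entries N U in
  [/\ shape T \in interlacing N mu, is_ssyt (shape T) T, bounded N T & add_top_entries N.+1 mu (shape T) T = U].
Proof.
move=> sU bU T; have sz := ssyt_size _ sU; have [shU pU rU cU] := sU.
have sU' i : sorted leq (nth [::] U i).
  have [iT|iT] := ltnP i (size U); last by rewrite nth_default.
  by have /all_nthP := rU; apply.
have bU' i : all (geq N.+1) (nth [::] U i).
  have [iT|iT] := ltnP i (size U); last by rewrite nth_default.
  by have /all_nthP := bU; apply.
have nT i : nth [::] T i = [seq t <- nth [::] U i | (t <= N)%N].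
  have [iN|iN] := ltnP i N; first by rewrite nth_mkseq.
  rewrite nth_default ?size_mkseq//; apply/esym/eqP.
  rewrite -(negbK (_ == _)) -has_filter; apply/hasPn => t /(nthP 0%N)[j]; rewrite sz => jm <-.
  by have := ssyt_row sU dmu jm; rewrite -ltnNge; apply: leq_ltn_trans.
have split_row i : nth [::] U i =
    nth [::] T i ++ nseq (nth 0 mu i - size (nth [::] T i)) N.+1.
  by rewrite nT -sz; exact: sorted_split.
have szT i : (size (nth [::] T i) <= nth 0 mu i)%N.
  by rewrite -sz (split_row i) size_cat leq_addr.
have nthT i j : (j < size (nth [::] T i))%N -> nth 0%N (nth [::] T i) j = nth 0%N (nth [::] U i) j.
  by move=> jT; rewrite (split_row i) nth_cat jT.
have row_low i : (nth 0 mu i.+1 <= size (nth [::] T i))%N.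
  rewrite leqNgt; apply/negP => lt; set j := size (nth [::] T i) in lt *.
  have := cU i j; rewrite mem_dg lt => /(_ isT).
  rewrite {1}(split_row i) nth_cat ltnn subnn nth_nseq subn_gt0.
  rewrite (leq_trans lt (dmu i)) ltnNge => /negP; apply.
  by have /allP := bU' i.+1; apply; apply: mem_nth; rewrite sz.
split.
- apply/mem_interlacing; rewrite size_map size_mkseq; split=> // j jN.
  by rewrite nth_shape row_low szT.
- split=> //.
  + apply/(all_nthP [::]) => i _; rewrite nT all_filter; apply/allP => t tU; apply/implyP => _.
    have iU : (i < size U)%N by rewrite ltnNge; apply: contraTN tU => iU; rewrite nth_default.
    have /(all_nthP [::]) /(_ i iU) /allP := pU; exact.
  + apply/(all_nthP [::]) => i _; rewrite nT; apply: sorted_filter => //; exact: leq_trans.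
  + move=> i j; rewrite mem_dg nth_shape => jT.
    have jm : (j < nth 0 mu i.+1)%N := leq_trans jT (szT _).
    rewrite !nthT//; last exact: leq_trans jm (row_low i).
    by apply: cU; rewrite mem_dg.
- by apply/(all_nthP [::]) => i _; rewrite nT; apply/allP => t; rewrite mem_filter => /andP[].
- apply: (@eq_from_nth _ [::]); rewrite size_mkseq -shU size_map// => i iU.
  rewrite nth_mkseq ?size_map// shU nth_shape [in RHS]split_row//.
Qed.

End GlueStep.

(** The recursive list enumerates the tableaux because [keep_low_entries] is a
    two-sided inverse of [add_top_entries]. *)
Lemma mem_tableaux N mu T : decr mu -> (size mu <= N)%N ->
  (T \in tableaux N mu) <-> is_ssyt mu T /\ bounded N T.
Proof.
elim: N mu T => [|N IH] mu T dmu smu.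
  rewrite leqn0 size_eq0 in smu; rewrite (eqP smu) inE; split=> [/eqP ->|[[+ _ _ _] _]].
    by split=> //; split=> // i j; rewrite mem_dg nth_nil.
  by case: T.
have IHn nu S : nu \in interlacing N mu -> (S \in tableaux N nu) <-> is_ssyt nu S /\ bounded N S.
  by move=> numu; apply: IH; [exact: interlacing_decr numu|have [-> _] := (mem_interlacing _ _ _).1 numu].
split=> [/allpairsPdep[nu [S [numu SN ->]]]|[sT bT]].
  by have [sS bS] := (IHn _ _ numu).1 SN; exact: add_top_entries_ssyt.
have [numu sS bS E] := keep_low_entries_ssyt dmu sT bT.
apply/allpairsPdep; exists (shape (keep_low_entries N T)), (keep_low_entries N T); split=> //.
by apply/IHn.
Qed.

Lemma uniq_tableaux N mu : decr mu -> (size mu <= N)%N -> uniq (tableaux N mu).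
Proof.
elim: N mu => [|N IH] mu dmu smu //=.
have side nu : nu \in interlacing N mu -> decr nu /\ (size nu <= N)%N.
  by move=> numu; split; [exact: interlacing_decr numu|have [-> _] := (mem_interlacing _ _ _).1 numu].
apply: allpairs_uniq_dep => [|nu numu|]; first exact: uniq_interlacing.
  by have [dnu snu] := side _ numu; exact: IH.
move=> _ _ /allpairsPdep[nu [T [numu TN ->]]] /allpairsPdep[nu' [T' [numu' TN' ->]]] /= E.
have [dnu snu] := side _ numu; have [dnu' snu'] := side _ numu'.
have [sT bT] := (mem_tableaux _ dnu snu).1 TN; have [sT' bT'] := (mem_tableaux _ dnu' snu').1 TN'.
have TT : T = T' by rewrite -(add_top_entriesK numu sT bT) E add_top_entriesK.
have [<- _ _ _] := sT; have [<- _ _ _] := sT'.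
by rewrite TT.
Qed.

Lemma schur_poly_tableaux (R : comNzRingType) (x : nat -> R) N mu : decr mu -> (size mu <= N)%N ->
  schur_poly x N mu = \sum_(T <- tableaux N mu) \prod_(j <- flatten T) x j.
Proof.
elim: N mu => [|N IH] mu dmu smu /=; first by rewrite big_seq1 big_nil.
rewrite big_allpairs_dep/= big_seq [RHS]big_seq; apply: eq_bigr => nu numu.
have dnu := interlacing_decr numu; have [snu _] := (mem_interlacing _ _ _).1 numu.
have snu' : (size nu <= N)%N by rewrite snu.
rewrite IH// mulr_suml big_seq [RHS]big_seq; apply: eq_bigr => T TN.
have [sT bT] := (mem_tableaux _ dnu snu').1 TN.
(* Row by row, with missing rows read as empty, both fillings have [N.+1] rows. *)
have extend (U : seq (seq nat)) : (size U <= N.+1)%N ->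
    \prod_(j <- flatten U) x j = \prod_(i < N.+1) \prod_(j <- nth [::] U i) x j.
  move=> sU; rewrite big_flatten (big_nth [::]) big_mkord (big_ord_widen _ (fun i => \prod_(j <- nth [::] U i) x j) sU).
  rewrite big_mkcond; apply: eq_bigr => i _; case: ltnP => // iU.
  by rewrite nth_default ?big_nil.
have sizeT : size T = N by have [shT _ _ _] := sT; rewrite -snu -shT size_map.
rewrite !extend ?size_mkseq ?sizeT// -big_split; apply: eq_bigr => i _ /=.
by rewrite nth_add_top_entries// big_cat big_nseq iter_mulr_1.
Qed.

(** * Ribbons as pairs of rows *)

Lemma mem_skew nu mu l c : ((l, c) \in skew_shape nu mu) = (nth 0%N mu l <= c < nth 0%N nu l)%N.
Proof. by rewrite in_fsetD !mem_dg -leqNgt. Qed.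

Section RibbonPath.
Implicit Types (b x y : nat * nat) (s : seq (nat * nat)).

(** Every step to the left or down lowers the content (column minus row) of a
    box by one.  The identity is kept free of subtractions. *)
Lemma path_content b s t : path left_or_below b s -> (t <= size s)%N ->
  ((nth b (b :: s) t).2 + b.1 + t = b.2 + (nth b (b :: s) t).1)%N.
Proof.
elim: s b t => [|x s IH] b [|t] //=; rewrite ?addn0// => /andP[bx ps] ts.
have := IH x t ps ts; rewrite (set_nth_default b x)//=.
by move: bx => /orP[]/andP[/eqP E1 /eqP E2]; lia.
Qed.

Lemma path_rows b s x : path left_or_below b s -> x \in b :: s ->
  (b.1 <= x.1 <= (last b s).1)%N.
Proof.
elim: s b x => [|y s IH] b x /=; first by rewrite inE => _ /eqP ->; rewrite leqnn.
move=> /andP[byy ps]; have ble : (b.1 <= y.1)%N by move: byy => /orP[]/andP[/eqP E1 _]; lia.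
rewrite inE => /orP[/eqP ->|/(IH _ _ ps)]; last by lia.
by have := IH y y ps (mem_head _ _); lia.
Qed.

Lemma path_steps_down b s l : path left_or_below b s -> (b.1 <= l < (last b s).1)%N ->
  exists c, (l, c) \in b :: s /\ (l.+1, c) \in b :: s.
Proof.
elim: s b => [|y s IH] b /=; first by lia.
move=> /andP[byy ps] bl; have [yl|yl] := leqP y.1 l.
  have [|c [c1 c2]] := IH y ps; first by lia.
  by exists c; rewrite !(in_cons b) c1 c2 !orbT.
move: byy => /orP[]/andP[/eqP E1 /eqP E2]; first by lia.
exists b.2; have -> : l = b.1 by lia.
by split; [|rewrite -E1 -E2]; rewrite -surjective_pairing !inE eqxx ?orbT.
Qed.

Lemma path_last_content b s : path left_or_below b s ->
  ((last b s).2 + b.1 + size s = b.2 + (last b s).1)%N.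
Proof.
by move=> ps; have := path_content ps (leqnn (size s)); rewrite -(last_nth b).
Qed.

Lemma path_content_order b s x : path left_or_below b s -> x \in b :: s ->
  (x.2 + b.1 <= b.2 + x.1)%N /\ ((last b s).2 + x.1 <= x.2 + (last b s).1)%N.
Proof.
move=> ps /(nthP b)[t ts <-]; have := path_content ps (ts : (t <= size s)%N).
have := path_last_content ps; set y := nth b (b :: s) t; set z := last b s.
by rewrite /= ltnS in ts; lia.
Qed.

(** A ribbon contains at most one box on each diagonal; this is what excludes
    two-by-two squares. *)
Lemma path_content_inj b s x y : path left_or_below b s -> x \in b :: s -> y \in b :: s ->
  (x.2 + y.1 = y.2 + x.1)%N -> x = y.
Proof.
move=> ps /(nthP b)[t ts xE] /(nthP b)[u us yE] E.
have := path_content ps (ts : (t <= size s)%N); have := path_content ps (us : (u <= size s)%N).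
rewrite xE yE => h1 h2.
have tu : t = u by lia.
by rewrite -xE tu yE.
Qed.

Lemma path_uniq b s : path left_or_below b s -> uniq (b :: s).
Proof.
move=> ps; pose e x y := (y.2 + x.1 < x.2 + y.1)%N.
apply: (@sorted_uniq _ e) => [y x z|x|]; rewrite /e; [lia|by rewrite ltnn|].
by apply: sub_path ps => x y /orP[]/andP[/eqP E1 /eqP E2]; rewrite /e; lia.
Qed.

End RibbonPath.

Section RibbonShapes.
Variables (mu nu : seq nat) (n : nat).
Hypothesis dmu : decr mu.
Let m := nth 0%N mu.

(** The path starts at the end of row [i] of [nu] and ends just after row [j] of
    [mu], because these boxes have extremal content.  Where it leaves row [l] for
    row [l + 1] it uses a common column, which gives [nu_(l+1) > mu_l]; a larger
    overlap would contain two boxes on the same diagonal.  The number of boxes is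
    the difference of contents along the path, plus one. *)
Lemma ribbon_is_ribbon_row : (0 < n)%N -> decr nu -> (dg mu `<=` dg nu)%fset -> is_ribbon n (skew_shape nu mu) ->
  exists i j, ribbon_fits m n i j /\ nth 0%N nu =1 ribbon_row m n i j.
Proof.
move=> n0 dnu /fsubsetP sub [[|b s] [sn _ sR]]; first by move: n0; rewrite -sn.
rewrite /= in sn * => ps.
have inR l c : ((l, c) \in b :: s) = (m l <= c < nth 0%N nu l)%N by rewrite sR mem_skew.
have mle l : (m l <= nth 0%N nu l)%N.
  case E : (m l) => [//|c]; have := sub (l, c); rewrite !mem_dg; apply.
  by rewrite -/m E.
set i := b.1; set j := (last b s).1; exists i, j.
have ij : (i <= j)%N by have := path_rows ps (mem_head _ _); lia.
have rows l : (m l < nth 0%N nu l)%N -> (i <= l <= j)%N.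
  by move=> ml; apply: (path_rows ps (x := (l, m l))); rewrite inR leqnn ml.
have := inR b.1 b.2; rewrite -surjective_pairing mem_head => /esym bR.
have := inR (last b s).1 (last b s).2; rewrite -surjective_pairing mem_last => /esym lR.
have [|b2 _] := path_content_order ps (x := (i, (nth 0%N nu i).-1)).
  by rewrite inR; rewrite -/i in bR; lia.
have [|_ l2] := path_content_order ps (x := (j, m j)).
  by rewrite inR; rewrite -/j in lR; lia.
have := path_last_content ps; rewrite -/i -/j => len.
rewrite -/i in bR; rewrite -/j in lR; rewrite /= -/i in b2; rewrite /= -/j in l2.
have nuE : (nth 0%N nu i + j = m j + n + i)%N by lia.
have inner l : (i <= l < j)%N -> nth 0%N nu l.+1 = (m l).+1.
  move=> /(path_steps_down ps)[c []]; rewrite !inR => c1 c2.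
  apply/eqP; rewrite eqn_leq andbC; apply/andP; split; first by lia.
  rewrite leqNgt; apply/negP => gt.
  have : (l, m l) = (l.+1, (m l).+1).
    apply: (path_content_inj ps); first by rewrite inR; lia.
      by rewrite inR gt andbT; apply: leqW; exact: dmu.
    by rewrite /= addnS.
  by case; lia.
split.
  apply/and3P; split=> //; first by lia.
  case E : (i) => [//|i'] /=; have := dnu i'; rewrite -E => d.
  have : ~~ (m i' < nth 0%N nu i')%N by apply/negP => /rows; lia.
  by have := mle i'; lia.
move=> l; rewrite /ribbon_row.
have outside : ~~ (i <= l <= j)%N -> nth 0%N nu l = m l.
  move=> lij; apply/eqP; rewrite eqn_leq mle andbT leqNgt.
  by apply/negP => /rows; apply/negP.
case: ltngtP => [li|il|->]; [by apply: outside; lia| |by lia].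
case: leqP => lj; last by apply: outside; lia.
by case: l il lj {outside} => // l il lj; rewrite inner//; lia.
Qed.

Section Converse.
Variables (i j : nat).
Hypotheses (v : ribbon_fits m n i j) (nuE : nth 0%N nu =1 ribbon_row m n i j).

Lemma ribbon_row_gt l : (m l < nth 0%N nu l)%N = (i <= l <= j)%N.
Proof.
have /and3P[ij v1 v2] := v; rewrite nuE /ribbon_row.
case: (ltngtP l i) => [||->] //=; rewrite ?ltnn//; last by lia.
move=> il; case: (leqP l j) => lj; last by rewrite ltnn.
by rewrite ltnS; case: (l) il => //= k _; exact: dmu.
Qed.

Lemma ribbon_row_geq l : (m l <= nth 0%N nu l)%N.
Proof.
have := ribbon_row_gt l; case: ltnP => [/ltnW//|_ /esym /negbT lij].
rewrite nuE /ribbon_row; have /and3P[ij v1 v2] := v.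
case: (ltngtP l i) => //; last by lia.
by move=> il; case: (leqP l j) => //; lia.
Qed.

(** Here [y] is the rest of a path that has reached [(l, a)]; a segment of row [l]
    ending at this box is put in front. *)
Lemma row_path l a k y : path left_or_below (l, a) y ->
  exists s, [/\ path left_or_below (l, a + k)%N s, last (l, a + k)%N s = last (l, a) y &
    forall x, (x \in (l, a + k)%N :: s) = (x.1 == l) && (a <= x.2 <= a + k)%N || (x \in y)].
Proof.
move=> py; elim: k => [|k [s [ps ls sE]]].
  exists y; rewrite addn0; split=> // -[x1 x2] /=; rewrite inE xpair_eqE /=.
  by congr ((_ && _) || _); lia.
exists ((l, a + k)%N :: s); rewrite addnS; split=> //=.
  by rewrite ps andbT /left_or_below /= !eqxx.
move=> x; rewrite inE sE orbA; congr (_ || _); case: x => x1 x2; rewrite xpair_eqE/=.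
by case: eqP => //= _; lia.
Qed.

Lemma staircase_path l d :
  (i <= l)%N -> (l + d = j)%N ->
  exists s, [/\ path left_or_below (l, (nth 0%N nu l).-1) s, last (l, (nth 0%N nu l).-1) s = (j, m j) &
    forall x, (x \in (l, (nth 0%N nu l).-1) :: s) =
      (l <= x.1 <= j)%N && (m x.1 <= x.2 < nth 0%N nu x.1)%N].
Proof.
have inner k : (i <= k < j)%N -> nth 0%N nu k.+1 = (m k).+1.
  move=> ikj; rewrite nuE /ribbon_row; have -> : (k.+1 < i)%N = false by lia.
  have -> : (k.+1 == i) = false by lia.
  by have -> : (k.+1 <= j)%N by lia.
elim: d l => [|d IH] l il lj.
  have lj' : l = j by lia.
  have lg : (m l < nth 0%N nu l)%N by rewrite ribbon_row_gt; lia.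
  have [//|s [ps ls sE]] := @row_path l (m l) ((nth 0%N nu l).-1 - m l)%N [::].
  have E : (m l + ((nth 0%N nu l).-1 - m l) = (nth 0%N nu l).-1)%N by lia.
  rewrite E in ps ls sE; exists s; split=> //; first by rewrite ls /= lj'.
  move=> x; rewrite sE orbF -lj' -eqn_leq eq_sym; case: eqP => //= <-; lia.
have [||s [ps ls sE]] := IH l.+1; [lia|lia|].
have lg : (m l < nth 0%N nu l)%N by rewrite ribbon_row_gt; lia.
have [|s' [ps' ls' sE']] := @row_path l (m l) ((nth 0%N nu l).-1 - m l)%N ((l.+1, (nth 0%N nu l.+1).-1) :: s).
  by rewrite /= ps andbT /left_or_below /= inner ?eqxx ?orbT//; lia.
have E : (m l + ((nth 0%N nu l).-1 - m l) = (nth 0%N nu l).-1)%N by lia.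
rewrite E in ps' ls' sE'; exists s'; split=> //; first by rewrite ls' /= ls.
move=> x; rewrite sE' sE; case: (ltngtP l x.1) => [lx|lx|<-] //=.
rewrite orbF; have -> : (l <= j)%N by lia.
by rewrite /=; lia.
Qed.

(** The path runs through the rows [i, ..., j] from right to left; the number of
    its boxes follows from the contents of its two ends. *)
Lemma ribbon_row_is_ribbon : (dg mu `<=` dg nu)%fset /\ is_ribbon n (skew_shape nu mu).
Proof.
split.
  by apply/fsubsetP => -[l c]; rewrite !mem_dg => cm; apply: leq_trans cm (ribbon_row_geq l).
have /and3P[ij v1 v2] := v.
have [|s [ps ls sE]] := @staircase_path i (j - i) (leqnn _); first by rewrite subnKC.
exists ((i, (nth 0%N nu i).-1) :: s); split=> //; last first.
- by move=> [l c]; rewrite sE mem_skew -ribbon_row_gt /m /=; lia.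
- exact: path_uniq.
- have := path_last_content ps; rewrite ls /=.
  have : (m i < nth 0%N nu i)%N by rewrite ribbon_row_gt leqnn ij.
  have : (nth 0%N nu i + j = m j + n + i)%N by rewrite nuE /ribbon_row ltnn eqxx; lia.
  by lia.
Qed.

Lemma ribbon_sgn_ribbon_row : ribbon_sgn (skew_shape nu mu) = (-1) ^+ (j - i).
Proof.
rewrite /ribbon_sgn; congr (_ ^+ _).
have -> : [fset b.1 | b in skew_shape nu mu]%fset = [fset l in iota i (j - i).+1]%fset.
  have /andP[ij _] := v; apply/fsetP => l; rewrite !inE mem_iota; apply/imfsetP/idP.
    move=> [[l' c] /=]; rewrite mem_skew => lc ->.
    by have := ribbon_row_gt l'; rewrite -/m in lc; lia.
  move=> lij; exists (l, m l) => //=; rewrite mem_skew leqnn ribbon_row_gt; lia.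
by rewrite card_fseq undup_id ?iota_uniq// size_iota.
Qed.

End Converse.
End RibbonShapes.

(** * Adding ribbons to partitions *)

Definition is_part (mu : seq nat) := sorted geq mu && all (leq 1) mu.

Lemma part_decr mu : is_part mu -> decr mu.
Proof. by move=> /andP[/sorted_decr]. Qed.

Lemma part_nth_gt0 mu i : is_part mu -> (0 < nth 0%N mu i)%N = (i < size mu)%N.
Proof.
move=> /andP[_ pmu]; have [im|im] := ltnP i (size mu); last by rewrite nth_default.
by have /(all_nthP 0%N) := pmu; apply.
Qed.

Lemma part_eq mu nu : is_part mu -> is_part nu -> nth 0%N mu =1 nth 0%N nu -> mu = nu.
Proof.
move=> pmu pnu E; apply: (@eq_from_nth _ 0%N) => //.
apply/eqP; rewrite eqn_leq; apply/andP; split; rewrite leqNgt; apply/negP.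
  by rewrite -(part_nth_gt0 _ pmu) E part_nth_gt0// ltnn.
by rewrite -(part_nth_gt0 _ pnu) -E part_nth_gt0// ltnn.
Qed.

Lemma decr_part mu : decr mu -> all (leq 1) mu -> is_part mu.
Proof.
move=> dmu pmu; rewrite /is_part pmu andbT; apply/(sortedP 0%N) => i _; exact: dmu.
Qed.

Definition adds_ribbon_part n mu nu :=
  [/\ is_part nu, (dg mu `<=` dg nu)%fset & is_ribbon n (skew_shape nu mu)].

Definition ribbon_additions N mu n : seq (seq nat) :=
  [seq ribbon_addition mu n i j | j <- iota 0 N, i <- [seq i <- iota 0 j.+1 | ribbon_fits (nth 0%N mu) n i j]].

Lemma part_ribbon_addition mu n i j : is_part mu -> ribbon_fits (nth 0%N mu) n i j -> is_part (ribbon_addition mu n i j).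
Proof.
move=> pmu v; have dmu := part_decr pmu; have /and3P[ij v1 v2] := v.
apply: decr_part; first exact: decr_ribbon_addition.
apply/(all_nthP 0%N) => l; rewrite size_mkseq => ls; rewrite nth_ribbon_addition//.
have [lj|jl] := leqP l j.
  have := ribbon_row_gt dmu v (nth_ribbon_addition mu n ij) i; rewrite leqnn ij nth_ribbon_addition// => gt.
  have [li|il] := ltnP l i.
    rewrite /ribbon_row li; have := decr_leq dmu (i := l) (j := i.-1).
    have i0 : (i == 0%N) = false by lia.
    by rewrite i0 /= in v2; lia.
  have := ribbon_row_gt dmu v (nth_ribbon_addition mu n ij) l; rewrite il lj nth_ribbon_addition//; lia.
have := ribbon_row_geq dmu v (nth_ribbon_addition mu n ij) l; rewrite nth_ribbon_addition//.
by have := part_nth_gt0 l pmu; lia.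
Qed.

Lemma ribbon_additionsP N mu n nu : (nu \in ribbon_additions N mu n) <->
  exists i j, [/\ (j < N)%N, ribbon_fits (nth 0%N mu) n i j & nu = ribbon_addition mu n i j].
Proof.
split=> [/allpairsPdep[j [i [jN]]]|[i [j [jN v ->]]]].
  rewrite mem_filter => /andP[v _] ->; exists i, j; split=> //.
  by rewrite mem_iota in jN.
apply/allpairsPdep; exists j, i; rewrite mem_filter v !mem_iota/= ltnS.
by have /andP[-> _] := v.
Qed.

(** A ribbon of [n] boxes added to [mu] cannot reach below row [size mu + n], so
    the list is complete as soon as [N] is at least this number. *)
Lemma mem_ribbon_additions N mu n nu : is_part mu -> (0 < n)%N -> (size mu + n <= N)%N ->
  (nu \in ribbon_additions N mu n) <-> adds_ribbon_part n mu nu.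
Proof.
move=> pmu n0 sN; have dmu := part_decr pmu.
split=> [/ribbon_additionsP[i [j [jN v ->]]]|[pnu sub rib]].
  have /andP[ij _] := v; split; first exact: part_ribbon_addition.
    by have [] := ribbon_row_is_ribbon dmu v (nth_ribbon_addition mu n ij).
  by have [] := ribbon_row_is_ribbon dmu v (nth_ribbon_addition mu n ij).
have [i [j [v E]]] := ribbon_is_ribbon_row dmu n0 (part_decr pnu) sub rib.
have /and3P[ij v1 v2] := v.
apply/ribbon_additionsP; exists i, j; split=> //; last first.
  by apply: part_eq => //; [exact: part_ribbon_addition|move=> l; rewrite E nth_ribbon_addition].
rewrite ltnNge; apply/negP => Nj.
have mj : nth 0%N mu j = 0%N by rewrite nth_default//; lia.
have mi : nth 0%N mu i.-1 = 0%N by rewrite nth_default//; lia.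
by rewrite mj mi in v1 v2; lia.
Qed.

(** The rows [i] and [j] are recovered as the first and the last row that grow. *)
Lemma uniq_ribbon_additions N mu n : is_part mu -> uniq (ribbon_additions N mu n).
Proof.
move=> pmu; have dmu := part_decr pmu; apply: allpairs_uniq_dep.
- exact: iota_uniq.
- by move=> j _; rewrite filter_uniq// iota_uniq.
move=> _ _ /allpairsPdep[j [i [_ +] ->]] /allpairsPdep[j' [i' [_ +] ->]] /=.
rewrite !mem_filter => /andP[v _] /andP[v' _] E.
have /andP[ij _] := v; have /andP[ij' _] := v'.
have R l : (i <= l <= j)%N = (i' <= l <= j')%N.
  rewrite -(ribbon_row_gt dmu v (nth_ribbon_addition mu n ij)) E.
  by rewrite -(ribbon_row_gt dmu v' (nth_ribbon_addition mu n ij')).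
have := R i; have := R j; have := R i'; have := R j'.
rewrite !leqnn ij ij' /= => h1 h2 h3 h4.
by have -> : i = i' by [lia]; have -> : j = j' by [lia].
Qed.

(** * Series and their coefficients *)

Section Coefficients.
Variable I : choiceType.
Variable R : comNzRingType.
Implicit Types (f g : series I R) (u v w : {cmonom I}).

(** The series reduced to the monomial [w]. *)
Definition series_delta w : series I R := fun u => (u == w)%:R.

Lemma series_deltaM v w : series_delta v * series_delta w = series_delta (mmul v w).
Proof.
apply/funext => u.
have E t x : monalg.mcoeff x (<< t >> : {malg R[{cmonom I}]}) = series_delta t x by rewrite mcoeffU1 eq_sym.
rewrite -E -[LHS]/(series_mul _ _ u).
rewrite (@series_mul_malg _ _ _ _ << v >> << w >> u); try by move=> *; exact: E.
by rewrite malgM_def fgmulUU mulr1.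
Qed.

Lemma series_deltaX w n : series_delta w ^+ n = series_delta (expcmn w n).
Proof.
elim: n => [|n IH]; first by rewrite expr0.
by rewrite exprS IH series_deltaM; case: n {IH} => [|n]; rewrite ?mulm1.
Qed.

Lemma series_sum_coef (J : Type) (r : seq J) (P : pred J) (F : J -> series I R) u :
  (\sum_(i <- r | P i) F i) u = \sum_(i <- r | P i) F i u.
Proof. by elim/big_rec2: _ => // i f a _ <-. Qed.

(** A coefficient of a product only depends on the coefficients of the divisors
    of the monomial; this allows infinitely many variables to be dropped. *)
Lemma series_mul_local f f' g g' u :
  (forall v, mon_dvd v u -> f v = f' v) -> (forall v, mon_dvd v u -> g v = g' v) ->
  (f * g) u = (f' * g') u.
Proof.
move=> ff' gg'; have [[F Ff] [G Gg]] := (malg_approx f u, malg_approx g u).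
rewrite -[LHS]/(series_mul _ _ u) -[RHS]/(series_mul _ _ u).
rewrite (series_mul_malg Ff Gg) (@series_mul_malg _ _ f' g' F G)// => v vu.
  by rewrite Ff// ff'.
by rewrite Gg// gg'.
Qed.

Lemma series_scalerAl (a : R) f g : a *: (f * g) = (a *: f) * g.
Proof.
apply/funext => u; have [[F Ff] [G Gg]] := (malg_approx f u, malg_approx g u).
rewrite series_scaleE -[X in _ * X]/(series_mul _ _ u) -[RHS]/(series_mul _ _ u).
rewrite (series_mul_malg Ff Gg) (@series_mul_malg _ _ (a *: f) g (a *: F) G)//.
  by rewrite -scalerAl mcoeffZ.
by move=> v vu; rewrite mcoeffZ Ff.
Qed.

Lemma series_signE n f : (-1) ^+ n * f = (-1) ^+ n *: f.
Proof. by rewrite -signr_odd mulr_sign -[in RHS]signr_odd scaler_sign. Qed.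

End Coefficients.

Lemma expcmnE (I : choiceType) (w : {cmonom I}) n i : expcmn w n i = (n * w i)%N.
Proof.
elim: n => [|n IH]; first by rewrite mul0n cm1.
have -> : expcmn w n.+1 = mmul w (expcmn w n) by case: n {IH} => [|n]; rewrite ?mulm1.
by rewrite cmM IH mulSn.
Qed.

Lemma expcmn_inj (I : choiceType) m (v w : {cmonom I}) : (0 < m)%N ->
  expcmn v m = expcmn w m -> v = w.
Proof.
move=> m0 E; apply/eqP/cmP => i; apply/eqP; rewrite -(eqn_pmul2l m0).
by rewrite -!expcmnE E.
Qed.

Lemma expcmnM (I : choiceType) m n (w : {cmonom I}) :
  expcmn w (n * m) = expcmn (expcmn w n) m.
Proof. by apply/eqP/cmP => i; rewrite !expcmnE; lia. Qed.

(** * The Murnaghan-Nakayama rule for Schur functions *)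

Lemma big_iota_ord (V : nmodType) N (P : pred nat) (F : nat -> V) :
  \sum_(i <- iota 0 N | P i) F i = \sum_(i < N | P i) F i.
Proof. by rewrite -[in LHS](subn0 N) big_mkord. Qed.

Section OneDegree.
Variable k : nat.
Implicit Types u v : {cmonom (nat * nat)%type}.

(** Only the variables of degree [k] are constrained. *)
Definition uses_first N u := forall j, (N < j)%N -> u (k, j) = 0%N.

Lemma uses_first_exists u : exists N0, forall N, (N0 <= N)%N -> uses_first N u.
Proof.
exists (\max_(i <- finsupp u) i.2)%N => N leN j Nj.
apply/eqP; rewrite cmE_eq0; apply/negP => ju.
have := leq_trans (@leq_bigmax_seq _ _ predT (fun i : (nat * nat)%type => i.2) _ ju isT) leN.
by rewrite leqNgt Nj.
Qed.

Lemma uses_first_dvd N u v : uses_first N u -> mon_dvd v u -> uses_first N v.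
Proof.
move=> lu [w vw] j Nj; have := lu j Nj; rewrite -vw cmM => /eqP.
by rewrite addn_eq0 => /andP[/eqP].
Qed.

Definition content_mon (s : seq nat) : {cmonom (nat * nat)%type} :=
  foldr (fun j w => mmul (ucm (k, j)) w) mone s.

Lemma prod_xvar s : \prod_(j <- s) xvar k j = series_delta _ (content_mon s).
Proof.
elim: s => [|j s IH]; first by rewrite big_nil.
by rewrite big_cons IH [xvar k j](_ : _ = series_delta _ (ucm (k, j)))// series_deltaM.
Qed.

Lemma content_mon_gt0 s t : t \in s -> (0 < content_mon s (k, t))%N.
Proof.
elim: s => //= j s IH; rewrite inE cmM => /orP[/eqP ->|/IH]; first by rewrite cmUU.
by move=> gt; rewrite addn_gt0 gt orbT.
Qed.

(** A tableau with an entry greater than [N] contributes a monomial divisible by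
    a variable that does not occur in [u]. *)
Lemma schur_coef N mu u : decr mu -> (size mu <= N)%N -> uses_first N u ->
  schur mu k u = schur_poly (xvar k) N mu u.
Proof.
move=> dmu sN lu; rewrite schur_poly_tableaux// series_sum_coef /schur /series_sum.
have sub : [set` tableaux N mu] `<=` [set T | is_ssyt mu T].
  by move=> T /= /(mem_tableaux _ dmu sN)[].
rewrite (fsbigE (tableaux N mu))//; last 2 first.
- exact: uniq_tableaux.
- move=> T /= sT nT; rewrite prod_xvar /series_delta.
  have /allPn[r rT /allPn[t tr]] : ~~ bounded N T.
    by apply: contra nT => bT; apply/(mem_tableaux _ dmu sN).
  rewrite -ltnNge => Nt; case: eqP => // uE.
  have : t \in flatten T by apply/flattenP; exists r.
  by move=> /content_mon_gt0; rewrite -uE lu.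
rewrite big_seq_cond [RHS]big_seq; apply: eq_bigl => T.
by apply/andP/idP => [[]//|TN]; split=> //; apply/mem_set/sub.
Qed.

Definition power_sum n : pseries := series_sum [set j | (0 < j)%N] (fun j => xvar k j ^+ n).

Lemma xvarX j n : xvar k j ^+ n = series_delta _ (expcmn (ucm (k, j)) n).
Proof. exact: series_deltaX. Qed.

Lemma power_sum_coef N n u : (0 < n)%N -> uses_first N u ->
  power_sum n u = (\sum_(i < N) xvar k i.+1 ^+ n) u.
Proof.
move=> n0 lu; rewrite series_sum_coef /power_sum /series_sum.
rewrite (fsbigE (iota 1 N)) ?iota_uniq//; last 2 first.
- by move=> j /=; rewrite mem_iota => /andP[].
- move=> j /= j0; rewrite mem_iota j0 /= add1n ltnS -ltnNge => Nj.
  rewrite xvarX /series_delta; case: eqP => // uE.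
  by have := lu j Nj; rewrite uE expcmnE cmUU muln1 => E; move: n0; rewrite E.
rewrite (iotaDl 1) big_map big_iota_ord.
by apply: eq_big => // i; rewrite add1n; apply/mem_set.
Qed.

(** The list [L] is arbitrary because the number of variables, hence the list
    [ribbon_additions N mu n] that appears, varies with the monomial. *)
Lemma schur_power_sum mu n L : is_part mu -> (0 < n)%N -> uniq L ->
  (forall nu, nu \in L <-> adds_ribbon_part n mu nu) ->
  schur mu k * power_sum n = \sum_(nu <- L) ribbon_sgn (skew_shape nu mu) *: schur nu k.
Proof.
move=> pmu n0 uL memL; have dmu := part_decr pmu; apply/funext => u.
have [N0 lowN] := uses_first_exists u; set N := maxn N0 (size mu + n).
have lu : uses_first N u by apply: lowN; exact: leq_maxl.
have sN : (size mu + n <= N)%N by exact: leq_maxr.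
have sN' : (size mu <= N)%N by apply: leq_trans sN; exact: leq_addr.
rewrite (@series_mul_local _ _ _ (schur_poly (xvar k) N mu) _ (\sum_(i < N) xvar k i.+1 ^+ n)).
- rewrite murnaghan_nakayama_schur_poly// (perm_big (ribbon_additions N mu n))/=; last first.
    apply: uniq_perm => //; first exact: uniq_ribbon_additions.
    move=> nu; apply/idP/idP => [/memL a|/(mem_ribbon_additions _ pmu n0 sN) a].
      by apply/(mem_ribbon_additions _ pmu n0 sN).
    by apply/memL.
  rewrite big_allpairs_dep big_iota_ord !series_sum_coef; apply: eq_bigr => j _.
  rewrite big_filter big_iota_ord !series_sum_coef.
  apply: eq_bigr => i v; have /andP[ij _] := v.
  rewrite (ribbon_sgn_ribbon_row dmu v (nth_ribbon_addition mu n ij)) series_signE !series_scaleE.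
  congr (_ * _); apply/esym/schur_coef => //; first exact: decr_ribbon_addition.
  by rewrite size_mkseq geq_max sN' ltn_ord.
- by move=> v /(uses_first_dvd lu) lv; exact: schur_coef.
- by move=> v /(uses_first_dvd lu) lv; exact: power_sum_coef.
Qed.

End OneDegree.

(** * The series of a block *)

Section PowVars.
Variables (m : nat) (m0 : (0 < m)%N).

Lemma powvars_exp f (v : {cmonom (nat * nat)%type}) : series_powvars m f (expcmn v m) = f v :> rat.
Proof.
rewrite /series_powvars (_ : [set w | _] = [set v]) ?fsbig_set1//.
by apply/seteqP; split=> w /= => [|->//]; exact: expcmn_inj.
Qed.

Lemma powvars_notexp f (u : {cmonom (nat * nat)%type}) : (forall v, expcmn v m <> u) ->
  series_powvars m f u = 0 :> rat.
Proof.
move=> nu; rewrite /series_powvars (_ : [set w | _] = set0) ?fsbig_set0//.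
by apply/seteqP; split=> w //= /nu.
Qed.

Lemma powvars_power_sum k n : series_powvars m (power_sum k n) = power_sum k (n * m).
Proof.
apply/funext => u; have [[v <-]|nu] := pselect (exists v, expcmn v m = u).
  rewrite powvars_exp; apply: eq_fsbigr => j _.
  rewrite !xvarX /series_delta expcmnM; congr (nat_of_bool _)%:R.
  by apply/eqP/eqP => [->//|]; exact: expcmn_inj.
rewrite powvars_notexp; last by move=> v vu; apply: nu; exists v.
apply/esym/fsbig1 => j _; rewrite xvarX /series_delta expcmnM.
by case: eqP => // E; case: nu; exists (expcmn (ucm (k, j)) n).
Qed.

(** Raising the variables to the power [m] multiplies the exponent of each power
    sum by [m].  It is checked on monomials that are [m]-th powers, the others
    having coefficient zero on both sides. *)
Lemma Pblock_power_sum d : Pblock d m = \sum_(k <- divisors d) k%:R *: power_sum k (d %/ k * m).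
Proof.
rewrite /Pblock; apply/funext => u; rewrite series_sum_coef.
under eq_bigr do rewrite series_scaleE -powvars_power_sum.
have [[v <-]|nu] := pselect (exists v, expcmn v m = u).
  rewrite powvars_exp /Pdeg series_sum_coef; apply: eq_bigr => k _.
  by rewrite powvars_exp.
have {}nu v : expcmn v m <> u by move=> vu; apply: nu; exists v.
by rewrite powvars_notexp// big1// => k _; rewrite powvars_notexp// mulr0.
Qed.

End PowVars.

(** * Types and their components *)

Lemma block_ge_total : total block_ge.
Proof. by move=> a b; rewrite /block_ge; lia. Qed.

Lemma block_ge_trans : transitive block_ge.
Proof. by move=> a b c; rewrite /block_ge; lia. Qed.

Lemma block_ge_anti : antisymmetric block_ge.
Proof.
move=> [a1 a2] [b1 b2]; rewrite /block_ge /= => H.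
by congr (_, _); lia.
Qed.

Lemma restr_part tau k : is_type tau -> is_part (restr tau k).
Proof.
move=> /andP[st pt]; apply/andP; split; last first.
  rewrite all_map; apply/allP => b; rewrite mem_filter => /andP[_ /(allP pt)].
  by case/andP.
have sf := sorted_filter block_ge_trans (fun b => b.1 == k) st.
rewrite /restr sorted_map; apply: (sub_in_sorted (P := fun b : block => b.1 == k)) sf.
  by move=> a b /eqP ak /eqP bk; rewrite /block_ge ak bk ltnn eqxx.
by apply/allP => b; rewrite mem_filter => /andP[].
Qed.

Lemma type_ext sigma tau : is_type sigma -> is_type tau ->
  (forall k, restr sigma k = restr tau k) -> sigma = tau.
Proof.
move=> /andP[ss _] /andP[st _] E; apply: (sorted_eq block_ge_trans block_ge_anti ss st).
have cE (s : seq block) d e : count_mem (d, e) s = count_mem e (restr s d).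
  rewrite /restr count_map count_filter; apply: eq_count => -[a b] /=.
  by rewrite xpair_eqE andbC.
by apply/allP => -[d e] _ /=; rewrite !cE E.
Qed.

(** The type with component [nu] in degree [k] and the components of [sigma] in
    the other degrees. *)
Definition set_restr (sigma : seq block) k nu : seq block :=
  sort block_ge ([seq b <- sigma | b.1 != k] ++ [seq (k, e) | e <- nu]).

Lemma sorted_const_degree k nu : sorted geq nu -> sorted block_ge [seq (k, e) | e <- nu].
Proof.
move=> snu; rewrite sorted_map; apply: sub_sorted snu => a b ab.
by rewrite /block_ge /= eqxx ltnn.
Qed.

Lemma restr_set_restr sigma k nu j : is_type sigma -> sorted geq nu ->
  restr (set_restr sigma k nu) j = if j == k then nu else restr sigma j.
Proof.
move=> /andP[ss _] snu.
rewrite /restr /set_restr (filter_sort block_ge_total block_ge_trans) filter_cat -filter_predI.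
case: eqP => [->|/eqP jk].
  rewrite (eq_filter (a2 := pred0)); last by move=> b /=; case: eqP.
  rewrite filter_pred0 /= (_ : filter _ _ = [seq (k, e) | e <- nu]).
    by rewrite (sorted_sort block_ge_trans) ?sorted_const_degree// -map_comp map_id.
  by apply/all_filterP; rewrite all_map; apply/allP => e _ /=.
rewrite (eq_filter (a2 := fun b => b.1 == j)); last first.
  by move=> b /=; case: eqP => // ->.
rewrite [X in _ ++ X](_ : _ = [::]) ?cats0.
  by rewrite (sorted_sort block_ge_trans)// sorted_filter//; exact: block_ge_trans.
by elim: nu {snu} => //= e nu ->; rewrite eq_sym (negbTE jk).
Qed.

Lemma set_restr_type sigma k nu : is_type sigma -> (0 < k)%N -> is_part nu ->
  is_type (set_restr sigma k nu).
Proof.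
move=> /andP[_ ps] k0 /andP[_ pnu]; apply/andP; split.
  exact: sort_sorted block_ge_total _.
rewrite all_sort all_cat all_map; apply/andP; split.
  by apply/allP => b; rewrite mem_filter => /andP[_ /(allP ps)].
by apply/allP => e /(allP pnu) /= e0; rewrite k0.
Qed.

Lemma schur_nil k : schur [::] k = 1.
Proof.
apply/funext => u; rewrite /schur /series_sum.
rewrite (_ : [set T | _] = [set [::]]) ?fsbig_set1 ?big_nil//.
apply/seteqP; split=> T /=; first by case: T => // r T [].
by move=> ->; split=> // i j; rewrite mem_dg nth_nil.
Qed.

(** A bound [M] independent of [tau] gives all the types of the sum the same
    range of degrees. *)
Lemma schur_tensor_prod tau M : (forall b, b \in tau -> (b.1 < M)%N) ->
  schur_tensor tau = \prod_(1 <= k < M) schur (restr tau k) k.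
Proof.
move=> tM; have [M0|M0] := posnP M.
  have -> : tau = [::] by case: tau tM => // b t /(_ b (mem_head _ _)); rewrite M0.
  by rewrite /schur_tensor big_nil M0 !big_geq.
rewrite /schur_tensor; set K := (\max_(b <- tau) b.1)%N.
have KM : (K.+1 <= M)%N.
  rewrite -(prednK M0) ltnS; apply/bigmax_leqP_seq => b /tM bM _.
  by rewrite -ltnS prednK.
rewrite [RHS](big_cat_nat _ KM)//= [X in _ = _ * X](_ : _ = 1) ?mulr1//.
rewrite big_nat_cond; apply: big1 => k /andP[/andP[Kk _] _].
rewrite /restr (_ : filter _ _ = [::]) ?schur_nil//.
apply/eqP; rewrite -(negbK (_ == _)) -has_filter; apply/hasPn => b bt.
have bK := @leq_bigmax_seq _ _ predT (fun b : block => b.1) _ bt isT.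
by rewrite ltn_eqF//; apply: leq_ltn_trans bK Kk.
Qed.

Lemma restr_degree tau b : b \in tau -> restr tau b.1 != [::].
Proof.
move=> bt; apply/eqP => /(congr1 (fun s => b.2 \in s)); rewrite in_nil => /negP; apply.
by apply/mapP; exists b => //; rewrite mem_filter eqxx.
Qed.

(** The types obtained from [sigma] by adding a ribbon in degree [k] are the
    [set_restr sigma k nu], for [nu] obtained from [sigma|_k]; the factors of
    degree different from [k] are common to all terms. *)
Lemma schur_tensor_power_sum sigma k n : is_type sigma -> (0 < k)%N -> (0 < n)%N ->
  forall c : rat, c *: (schur_tensor sigma * power_sum k n) =
  \sum_(tau \in [set tau | adds_ribbon n k sigma tau])
    (ribbon_sgn (skew_shape (restr tau k) (restr sigma k)) * c) *: schur_tensor tau.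
Proof.
move=> ts k0 n0 c; set mu := restr sigma k; have pmu : is_part mu := restr_part k ts.
pose L := ribbon_additions (size mu + n) mu n.
have memL nu : nu \in L <-> adds_ribbon_part n mu nu by apply: mem_ribbon_additions.
have uL : uniq L := uniq_ribbon_additions _ _ pmu.
have partL nu : nu \in L -> is_part nu by move=> /memL[].
have resE nu j : nu \in L -> restr (set_restr sigma k nu) j = if j == k then nu else restr sigma j.
  by move=> /partL/andP[snu _]; exact: restr_set_restr.
have typeL nu : nu \in L -> is_type (set_restr sigma k nu) by move=> /partL; exact: set_restr_type.
have ribL nu : nu \in L -> adds_ribbon n k sigma (set_restr sigma k nu).
  move=> nuL; have [_ sub rib] := (memL nu).1 nuL; split; first exact: typeL.
  - by move=> j /negbTE jk; rewrite resE// jk.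
  - by rewrite resE// eqxx.
  - by rewrite resE// eqxx.
have Lrib tau : adds_ribbon n k sigma tau -> tau \in map (set_restr sigma k) L.
  move=> [tt E sub rib]; have nuL : restr tau k \in L.
    by apply/memL; split=> //; exact: restr_part.
  apply/mapP; exists (restr tau k) => //; apply: type_ext => // [|j]; first exact: typeL.
  by rewrite resE//; case: eqP => [->//|/eqP/E].
rewrite (fsbigE (map (set_restr sigma k) L)); last 3 first.
- rewrite map_inj_in_uniq// => nu nu' nuL nuL' /(congr1 (restr ^~ k)).
  by rewrite !resE// eqxx.
- by move=> tau /= /mapP[nu nuL ->]; exact: ribL.
- by move=> tau /= /Lrib ->.
rewrite big_seq_cond (eq_bigl (fun tau => tau \in map (set_restr sigma k) L)); last first.
  move=> tau; apply/andP/idP => [[]//|tL]; split=> //; apply/mem_set => /=.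
  by case/mapP: tL => nu nuL ->; exact: ribL.
rewrite -big_seq big_map.
pose M := (maxn (\max_(b <- sigma) b.1) k).+1.
have sM b : b \in sigma -> (b.1 < M)%N.
  move=> bs; rewrite ltnS leq_max; apply/orP; left.
  exact: (@leq_bigmax_seq _ _ predT (fun b : block => b.1) _ bs isT).
have kM : (k < M)%N by rewrite ltnS leq_maxr.
have splitk tau : (forall b, b \in tau -> (b.1 < M)%N) -> schur_tensor tau =
    schur (restr tau k) k * \prod_(1 <= j < M | j != k) schur (restr tau j) j.
  move=> tM; rewrite (schur_tensor_prod tM) (bigD1_seq k) ?iota_uniq//.
  by rewrite mem_index_iota k0 kM.
rewrite (splitk _ sM) -/mu mulrAC (schur_power_sum k pmu n0 uL memL) mulr_suml scaler_sumr.
rewrite big_seq [RHS]big_seq; apply: eq_bigr => nu nuL.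
rewrite resE// eqxx -series_scalerAl scalerA mulrC; congr (_ *: _).
rewrite splitk; last first.
  move=> b bt; have := restr_degree bt; rewrite resE//.
  case: (eqVneq b.1 k) => [->//|_]; rewrite /restr => nz.
  have [b' b's /eqP <-] : exists2 b', b' \in sigma & b'.1 == b.1.
    by apply/hasP; rewrite has_filter; apply: contraNN nz => /eqP ->.
  exact: sM.
rewrite resE// eqxx; congr (_ * _); apply: eq_bigr => j /negbTE jk.
by rewrite resE// jk.
Qed.

Unset Implicit Arguments.

Theorem theorem6 (sigma : seq block) (d m : nat) :
  is_type sigma -> (0 < d)%N -> (0 < m)%N ->
  schur_tensor sigma * Pblock d m =
  \sum_(k <- divisors d)
    \sum_(tau \in [set tau | adds_ribbon ((d * m) %/ k) k sigma tau])
      (ribbon_sgn (skew_shape (restr tau k) (restr sigma k)) * k%:R)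
        *: schur_tensor tau.
Proof.
move=> ts d0 m0; rewrite Pblock_power_sum// mulr_sumr big_seq [RHS]big_seq.
apply: eq_bigr => k; rewrite -dvdn_divisors// => kd.
have k0 : (0 < k)%N := dvdn_gt0 d0 kd.
rewrite -divn_mulAC// -schur_tensor_power_sum//; last by rewrite muln_gt0 divn_gt0// dvdn_leq.
by rewrite mulrC -series_scalerAl mulrC.
Qed.
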